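(* Suppose that the coefficient field $A(y,\omega)$ satisfies the ellipticity bounds with constants $0<\alpha\le\beta$ and is stationary, i.e. $A(y+\mathbf{k},\omega)=A(y,\tau_{\mathbf{k}}\omega)$ for every $\mathbf{k}\in\mathbb{Z}^d$, a.e. $y$ and $\mathbb{P}$-a.s. Assume that $\delta<1$ and $f\in L^2(D)$. Let $\hat u(\cdot,\omega)\in H_0^1(D)$ be the weak solution of $$-\mathrm{div}(\hat A(x,\omega)\nabla\hat u(x,\omega))=f(x)\ \text{ in }D,\qquad \hat u(x,\omega)=0\ \text{ on }\partial D,$$ and let $u_0^0\in H^1_0(D)$ be the weak solution of $$-\mathrm{div}\big(\mathbb E[\hat A^0]\nabla u_0^0(x)\big)=f(x)\ \text{ in }D,\qquad u_0^0=0\ \text{ on }\partial D.$$ Then there is a constant $C_1>0$ independent of $\delta$ such that $$\mathbb E\big(\|\hat u(\cdot,\omega)-u_0^0\|^2_{H^1(D)}\big)\le C_1\,\delta^2\,\|f\|^2_{L^2(D)}.$$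
   Context: Let $d\in\{1,2,3\}$, $D\subset\mathbb{R}^d$ a bounded domain, $(\Omega,\mathcal F,\mathbb P)$ a probability space with expectation $\mathbb E$ and variance $\mathrm{Var}$, and $\varepsilon>0$. For an integer $M\ge 1$ and $\mathbf k\in\mathbb Z^d$ let $\mathcal Q_M=(0,M)^d$, $\mathcal Q_M^{\mathbf k}=\mathcal Q_M+M\mathbf k$. $\{e_i\}_{i=1}^d$ is the canonical basis of $\mathbb R^d$. $f$ is deterministic. The coefficient field $A(y,\omega)=(a_{ij}(y,\omega))$, $y\in\mathbb R^d$, is a random field of invertible real $d\times d$ matrices with $L^\infty$ entries; the ellipticity bounds are $\alpha|\xi|^2\le (A(y,\omega)\xi,\xi)\le\beta|\xi|^2$ for all $\xi\in\mathbb R^d$, a.e. $y$, $\mathbb P$-a.s. $(\tau_{\mathbf k})_{\mathbf k\in\mathbb Z^d}$ is an action of $\mathbb Z^d$ on $\Omega$ that preserves $\mathbb P$ and is ergodic (if $E\in\mathcal F$ satisfies $\tau_{\mathbf k}E=E$ for all $\mathbf k$, then $\mathbb P(E)\in\{0,1\}$). Equivalent matrix: for $\mathbf k\in\mathbb Z^d$ let $\mathbb N^{\mathbf k}_{e_i}(\cdot,\omega)$ be the $\mathcal Q_M^{\mathbf k}$-periodic (i.e. $M\mathbb Z^d$-periodic) $H^1_{loc}$ weak solution, unique up to an additive constant, of $-\mathrm{div}[A(y,\omega)(e_i+\nabla\mathbb N^{\mathbf k}_{e_i}(y,\omega))]=0$ in $\mathcal Q_M^{\mathbf k}$ (with periodic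 boundary conditions). Set $$\hat a^{\mathbf k}_{ij}(\omega)=\frac1{|\mathcal Q_M|}\int_{\mathcal Q_M}(e_i+\nabla\mathbb N^{\mathbf k}_{e_i}(y,\omega))^TA(y+M\mathbf k,\omega)(e_j+\nabla\mathbb N^{\mathbf k}_{e_j}(y,\omega))\,dy,$$ $\hat A^{\mathbf k}=(\hat a_{ij}^{\mathbf k})$, and $\hat A(x,\omega):=\hat A^{\mathbf k}(\omega)$ for $x\in D\cap\varepsilon\mathcal Q_M^{\mathbf k}$. Perturbation form: $\hat A(x,\omega)=\mathbb E(\hat A^0)+\delta A_1(x,\omega)$ with $\delta=\max_{i,j}\sqrt{\mathrm{Var}(\hat a^0_{ij})}$ and $A_1=(a^1_{ij})$, $a^1_{ij}\in L^2(\Omega,L^\infty(D))$, where it is assumed that $\mathbb P\{\omega:\|a^1_{ij}(\cdot,\omega)\|_{L^\infty(D)}\le\bar a\}=1$ for all $i,j$, with a constant $\bar a$ independent of $\delta$. *)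

(* Defs.v *)
From HB Require Import structures.
From mathcomp Require Import all_boot all_order all_algebra.
From mathcomp Require Import all_classical all_reals all_analysis.
Set Implicit Arguments. Unset Strict Implicit. Unset Printing Implicit Defensive.
Import Order.TTheory GRing.Theory Num.Theory numFieldNormedType.Exports.
Local Open Scope classical_set_scope.
Local Open Scope ring_scope.

Definition measure_rV_display : measure_display.
Proof. exact: default_measure_display. Qed.

(* R^n carries the product sigma-algebra of n Borel copies of R, generated by
   the coordinate maps; it coincides with the Borel sigma-algebra of 'rV[R]_n. *)
Section measurable_rV.
Context {R : realType} (n : nat).

Let coor (i : 'I_n) (v : 'rV[R]_n) : R := v ord0 i.

Let rV_set0 : g_sigma_preimage coor set0.
Proof. exact: sigma_algebra0. Qed.

Let rV_setC A : g_sigma_preimage coor A -> g_sigma_preimage coor (~` A).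
Proof. exact: sigma_algebraC. Qed.

Let rV_bigcup (F : (set 'rV[R]_n)^nat) :
  (forall i, g_sigma_preimage coor (F i)) ->
  g_sigma_preimage coor (\bigcup_i (F i)).
Proof. exact: sigma_algebra_bigcup. Qed.

HB.instance Definition _ := @isMeasurable.Build measure_rV_display
  'rV[R]_n (g_sigma_preimage coor) rV_set0 rV_setC rV_bigcup.

Lemma measurable_coord (i : 'I_n) :
  measurable_fun [set: 'rV[R]_n] (fun v : 'rV[R]_n => v ord0 i).
Proof.
move=> _ Y mY; rewrite setTI; apply: sub_sigma_algebra => /=.
rewrite -bigcup_seq/=; exists i => /=; first by rewrite mem_index_enum.
by exists Y => //; rewrite setTI.
Qed.

Lemma measurable_fun_coord d (T : measurableType d) (f : T -> 'rV[R]_n) :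
  (forall i, measurable_fun [set: T] (fun x => f x ord0 i)) ->
  measurable_fun [set: T] f.
Proof.
move=> mf.
have H : g_sigma_preimage (fun i => coor i \o f) `<=` measurable.
  apply: smallest_sub; first exact: sigma_algebra_measurable.
  by rewrite -bigcup_seq; apply: bigcup_sub => i _ A [B mB <-]; exact: mf.
move=> _ A mA; apply: H; by rewrite g_sigma_preimage_comp; exists A.
Qed.

End measurable_rV.

Section lebesgue_rV.
Context {R : realType}.

Definition cons_rV n (p : measurableTypeR R * 'rV[R]_n) : 'rV[R]_n.+1 :=
  row_mx (const_mx p.1 : 'rV[R]_1) p.2.

Lemma measurable_cons_rV n : measurable_fun setT (@cons_rV n).
Proof.
apply: measurable_fun_coord => i.
case: (splitP (i : 'I_(1 + n))) => j ij.
- have {ij}-> : i = lshift n j by apply/val_inj.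
  rewrite (_ : (fun x => _) = fst); first exact: measurable_fst.
  by apply/funext => x; apply: etrans (row_mxEl _ _ _ _) _; rewrite mxE.
- have {ij}-> : i = rshift 1 j by apply/val_inj.
  rewrite (_ : (fun x => _) = (fun v : 'rV_n => v ord0 j) \o snd).
    exact: measurableT_comp (measurable_coord j) measurable_snd.
  by apply/funext => x; exact: row_mxEr.
Qed.

Section step.
Variables (n : nat) (mu : {sigma_finite_measure set 'rV[R]_n -> \bar R}).

Definition lebesgue_cons : set 'rV[R]_n.+1 -> \bar R :=
  pushforward (lebesgue_measure \x mu)%E (@cons_rV n).

Let lc0 : lebesgue_cons set0 = 0%E.
Proof. by rewrite /lebesgue_cons /pushforward preimage_set0 measure0. Qed.
Let lc_ge0 A : (0 <= lebesgue_cons A)%E.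
Proof. by rewrite /lebesgue_cons /pushforward; exact: measure_ge0. Qed.

Let lc_sigma : semi_sigma_additive lebesgue_cons.
Proof.
move=> F mF tF mUF; rewrite /lebesgue_cons /pushforward preimage_bigcup.
have mpre A : measurable A -> measurable (@cons_rV n @^-1` A).
  by move=> mA; rewrite -[X in measurable X]setTI; exact: measurable_cons_rV.
apply: measure_semi_sigma_additive => [k| |].
- exact: mpre.
- apply/trivIsetP => /= i j _ _ ij; rewrite -preimage_setI.
  by move/trivIsetP : tF => /(_ _ _ _ _ ij) ->//; rewrite preimage_set0.
- by rewrite -preimage_bigcup; exact: mpre.
Qed.

HB.instance Definition _ := isMeasure.Build _ _ _
  lebesgue_cons lc0 lc_ge0 lc_sigma.

Let lc_sigma_finite : sigma_finite setT lebesgue_cons.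
Proof.
have [F TF Foo] : sigma_finite setT (@lebesgue_measure R \x mu)%E.
  have /sigma_finiteP[F [TF ndF Foo]] := sigma_finiteT (@lebesgue_measure R).
  have /sigma_finiteP[G [TG ndG Goo]] := sigma_finiteT mu.
  exists (fun n => F n `*` G n).
    rewrite -setXTT TF TG predeqE => -[x y]; split.
      move=> [/= [k _ Fkx] [l _ Gly]]; exists (maxn k l) => //; split.
      - by move: x Fkx; exact/subsetPset/ndF/leq_maxl.
      - by move: y Gly; exact/subsetPset/ndG/leq_maxr.
    by move=> [k _ []/= ? ?]; split; exists k.
  move=> k; have [? ?] := Foo k; have [? ?] := Goo k.
  split; first exact: measurableX.
  by rewrite product_measure1E// lte_mul_pinfty// ge0_fin_numE.
pose u (v : 'rV[R]_n.+1) : measurableTypeR R * 'rV[R]_n :=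
  (v ord0 ord0, \row_j v ord0 (rshift 1 j)).
have mcut : measurable_fun setT u.
  apply/measurable_fun_pairP; split; first exact: measurable_coord.
  apply: measurable_fun_coord => i.
  rewrite (_ : (fun x => _) = (fun v : 'rV_n.+1 => v ord0 (rshift 1 i))).
    exact: measurable_coord.
  by apply/funext => x; rewrite mxE.
have uK p : u (cons_rV p) = p.
  case: p => x v; congr pair.
    have -> : ord0 = lshift n ord0 :> 'I_(1 + n) by apply/val_inj.
    by apply: etrans (row_mxEl _ _ _ _) _; rewrite mxE.
  by apply/rowP => j; rewrite mxE; exact: row_mxEr.
exists (fun k => u @^-1` F k).
  by rewrite -preimage_bigcup -TF preimage_setT.
move=> k; have [mFk Fk] := Foo k; split.
  by rewrite -[X in measurable X]setTI; exact: mcut.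
rewrite /lebesgue_cons /pushforward (_ : _ @^-1` _ = F k)//.
by apply/seteqP; split=> p; rewrite /preimage/= uK.
Qed.

HB.instance Definition _ := Measure_isSigmaFinite.Build _ _ _
  lebesgue_cons lc_sigma_finite.

End step.

(* n-dimensional Lebesgue measure, as the n-fold product of lebesgue_measure. *)
Fixpoint lebesgue_rV n : {sigma_finite_measure set 'rV[R]_n -> \bar R} :=
  match n with
  | 0 => \d_(0 : 'rV[R]_0)
  | n.+1 => lebesgue_cons (lebesgue_rV n)
  end.

End lebesgue_rV.

Section linear_algebra.
Context {R : realType} {d : nat}.

Definition basis_vec (i : 'I_d) : 'rV[R]_d := delta_mx ord0 i.

Definition dotv (u v : 'rV[R]_d) : R := (u *m v^T) ord0 ord0.

(* (B u, v) = v^T B u, vectors of R^d being represented by rows. *)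
Definition form (B : 'M[R]_d) (u v : 'rV[R]_d) : R :=
  (v *m B *m u^T) ord0 ord0.

Definition vec_of_int (k : 'rV[int]_d) : 'rV[R]_d := map_mx intr k.

Definition cube (M : nat) (k : 'rV[int]_d) : set 'rV[R]_d :=
  [set y | forall i, (M%:R * (k ord0 i)%:~R < y ord0 i) /\
                     (y ord0 i < M%:R * (k ord0 i)%:~R + M%:R)].

End linear_algebra.

Section function_spaces.
Context {R : realType} {d : nat}.
Notation mu := (@lebesgue_rV R d).
Implicit Types (D : set 'rV[R]_d) (u v f : 'rV[R]_d -> R)
               (Du Dv : 'rV[R]_d -> 'rV[R]_d).

Definition domain D := [/\ open D, connected D & D !=set0].

Definition L2normsq D f : \bar R := \int[mu]_(x in D) (f x ^+ 2)%:E.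

Definition in_L2 D f := measurable_fun D f /\ (L2normsq D f < +oo)%E.

Definition Linfty_norm D f : \bar R := 'N[mu]_+oo[EFin \o (f \_ D)]%E.

Definition in_Linfty D f := measurable_fun D f /\ (Linfty_norm D f < +oo)%E.

Fixpoint continuously_derivable (n : nat) (phi : 'rV[R]_d -> R) : Prop :=
  continuous phi /\
  (if n is m.+1 then
     forall i, (forall x, derivable phi x (basis_vec i)) /\
               continuously_derivable m (fun x => 'D_(basis_vec i) phi x)
   else True).

Definition smooth phi := forall n, continuously_derivable n phi.

Definition grad (phi : 'rV[R]_d -> R) (x : 'rV[R]_d) : 'rV[R]_d :=
  \row_i 'D_(basis_vec i) phi x.

Definition test_function D phi :=
  [/\ smooth phi, compact (closure [set x | phi x != 0])
    & closure [set x | phi x != 0] `<=` D].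

Definition weak_gradient D u Du :=
  forall phi, test_function D phi -> forall i,
    \int[mu]_(x in D) (u x * grad phi x ord0 i) =
    - \int[mu]_(x in D) (Du x ord0 i * phi x).

(* Sobolev functions are handled as pairs (u, Du) of a function and a
   representative of its weak gradient. *)
Definition in_H1 D u Du :=
  [/\ in_L2 D u, forall i, in_L2 D (fun x => Du x ord0 i)
    & weak_gradient D u Du].

Definition H1normsq D u Du : \bar R :=
  \int[mu]_(x in D) (u x ^+ 2 + dotv (Du x) (Du x))%:E.

(* H^1_0(D): the closure of C_c^oo(D) in H^1(D). *)
Definition in_H10 D u Du :=
  in_H1 D u Du /\
  exists phi : nat -> 'rV[R]_d -> R,
    (forall n, test_function D (phi n)) /\
    H1normsq D (phi n \- u) (grad (phi n) \- Du) @[n --> \oo] --> 0%E.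

Definition in_H1loc u Du :=
  forall O : set 'rV[R]_d, open O -> bounded_set O -> in_H1 O u Du.

Definition periodic (M : nat) u :=
  forall k : 'rV[int]_d,
    {ae mu, forall x, u (x + M%:R *: vec_of_int k) = u x}.

Definition in_H1per (M : nat) u Du := in_H1loc u Du /\ periodic M u.

Definition weak_solution D (B : 'rV[R]_d -> 'M[R]_d) f u Du :=
  in_H10 D u Du /\
  forall v Dv, in_H10 D v Dv ->
    \int[mu]_(x in D) form (B x) (Du x) (Dv x) =
    \int[mu]_(x in D) (f x * v x).

(* N is a weak solution of -div [B (xi + grad N)] = 0 in M k + (0, M)^d with
   periodic boundary conditions. *)
Definition corrector (B : 'rV[R]_d -> 'M[R]_d) (M : nat) (k : 'rV[int]_d)
    (xi : 'rV[R]_d) N DN :=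
  in_H1per M N DN /\
  forall v Dv, in_H1per M v Dv ->
    \int[mu]_(y in cube M k) form (B y) (xi + DN y) (Dv y) = 0.

End function_spaces.

Section random_coefficients.
Context {R : realType} {d : nat} {disp : measure_display}
        {Omega : measurableType disp}.
Variable P : probability Omega R.
Notation mu := (@lebesgue_rV R d).

Record ergodic_action (tau : 'rV[int]_d -> Omega -> Omega) : Prop := {
  action0 : forall w, tau 0 w = w ;
  actionD : forall k l w, tau (k + l) w = tau k (tau l w) ;
  action_measurable : forall k, measurable_fun setT (tau k) ;
  action_preserves :
    forall k E, measurable E -> P (tau k @^-1` E) = P E ;
  action_ergodic :
    forall E, measurable E -> (forall k, tau k @` E = E) ->
      P E = 0%E \/ P E = 1%E }.

Section field.
Variable A : 'rV[R]_d -> Omega -> 'M[R]_d.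

Record coefficient_field : Prop := {
  field_measurable : forall i j, measurable_fun setT
    (fun p : 'rV[R]_d * Omega => A p.1 p.2 i j) ;
  field_invertible :
    {ae P, forall w, {ae mu, forall y, A y w \in unitmx}} ;
  field_Linfty :
    {ae P, forall w, forall i j, in_Linfty setT (fun y => A y w i j)} }.

Definition elliptic (alpha beta : R) :=
  {ae P, forall w, {ae mu, forall y, forall xi : 'rV[R]_d,
    alpha * dotv xi xi <= form (A y w) xi xi <= beta * dotv xi xi}}.

Definition stationary (tau : 'rV[int]_d -> Omega -> Omega) :=
  forall k, {ae P, forall w, {ae mu, forall y,
    A (y + vec_of_int k) w = A y (tau k w)}}.

Variables (M : nat)
  (DN : 'rV[int]_d -> 'I_d -> Omega -> 'rV[R]_d -> 'rV[R]_d).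

(* DN k i w is the gradient of the corrector N^k_(e_i) (., w). *)
Definition equivalent_matrix (k : 'rV[int]_d) (w : Omega) : 'M[R]_d :=
  \matrix_(i, j) ((fine (mu (cube M 0)))^-1 *
    \int[mu]_(y in cube M 0)
      form (A (y + M%:R *: vec_of_int k) w)
           (basis_vec j + DN k j w y) (basis_vec i + DN k i w y)).

(* If x lies in the open cell eps (M k + (0, M)^d), then k is the vector of the
   floors of x_i / (eps M); the cells cover R^d up to a Lebesgue-null set. *)
Definition cell_index (eps : R) (x : 'rV[R]_d) : 'rV[int]_d :=
  \row_i Num.floor (x ord0 i / (eps * M%:R)).

Definition equivalent_field (eps : R) (x : 'rV[R]_d) (w : Omega) : 'M[R]_d :=
  equivalent_matrix (cell_index eps x) w.

Definition mean_equivalent_matrix : 'M[R]_d :=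
  \matrix_(i, j) fine 'E_P[fun w => equivalent_matrix 0 w i j].

Definition max_std_dev : R :=
  \big[Num.max/0]_(i < d) \big[Num.max/0]_(j < d)
    Num.sqrt (fine 'V_P[fun w => equivalent_matrix 0 w i j]).

End field.

(* The Bochner space L^2(Omega, L^oo(D)): strong measurability is a.s.
   approximability by simple L^oo(D)-valued functions. *)
Definition simple_Linfty (D : set 'rV[R]_d)
    (s : Omega -> 'rV[R]_d -> R) :=
  exists (n : nat) (E : 'I_n -> set Omega) (g : 'I_n -> 'rV[R]_d -> R),
    [/\ forall l, measurable (E l), forall l, in_Linfty D (g l)
      & forall w x, s w x = \sum_(l < n) \1_(E l) w * g l x].

Definition in_L2_Linfty (D : set 'rV[R]_d) (a : Omega -> 'rV[R]_d -> R) :=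
  [/\ {ae P, forall w, in_Linfty D (a w)},
      (exists s : nat -> Omega -> 'rV[R]_d -> R,
        (forall n, simple_Linfty D (s n)) /\
        {ae P, forall w,
          Linfty_norm D (a w \- s n w) @[n --> \oo] --> 0%E})
    & (\int[P]_w (Linfty_norm D (a w) ^+ 2) < +oo)%E].

End random_coefficients.

(* Main.v *)
(** The difference [w = uhat - u00] satisfies [-div (Ahat grad w) = div ((Ahat - EA) grad u00)],
    where [Ahat - EA = delta A1] is bounded by [delta abar].  Coercivity of [Ahat], coercivity
    of [EA] and the Poincare inequality therefore give
    [||w||_{H^1} <= C delta ||grad u00|| <= C' delta ||f||] almost surely, with constants that
    depend on [D], [alpha] and [abar] only.

    Coercivity of the equivalent matrices is Jensen's inequality, the gradient of a periodic
    function having mean zero over a period.  Coercivity of the mean [EA] also needs the matrix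
    of the cell 0 to be almost surely measurable, which is not assumed.  The matrix of a cell
    that meets [D] is measurable because [A1] is, and by stationarity and uniqueness of the
    correctors it is the matrix of the cell 0 composed with a measure-preserving bijection.
    That uniqueness uses that the weak gradient of a periodic function is periodic: its
    integrals over boxes are limits of integrals against smooth cut-offs, hence invariant under
    the periods, and boxes form a pi-system that generates the Borel sets. *)
Require Import Defs.
From HB Require Import structures.
From mathcomp Require Import all_boot all_order all_algebra.
From mathcomp Require Import all_classical all_reals all_analysis.
From mathcomp Require Import measurable_realfun ess_sup_inf ring lra.
Set Implicit Arguments. Unset Strict Implicit. Unset Printing Implicit Defensive.
Import Order.TTheory GRing.Theory Num.Theory numFieldNormedType.Exports.
Local Open Scope classical_set_scope.
Local Open Scope ring_scope.

(** Measurability in the random parameter is not assumed for the correctors or for [uhat], so the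
    estimates are pathwise: they hold for each sample outside a null set. Integrating them is
    possible because the integral is defined for every function and is monotone on nonnegative ones.
    Linearity, however, may fail without measurability, and coercivity of the mean matrix rests on
    linearity; this is why its entries must first be identified with bounded measurable random
    variables. The perturbation identity thus serves twice, without circularity. At first [EA] and
    [delta] enter as arbitrary constants, only to make the matrix of one cell measurable and
    bounded. Once [EA] is known to be coercive, the same identity measures the distance between
    [Ahat] and [EA]. The final constant is built from the Poincare constant CP = 4 L^2 of a domain
    contained in (-L, L)^d and from (CP + 1) CP (d abar)^2 / alpha^4. *)

Local Notation form := Defs.form.

(** * Square-integrable functions *)

Section square_integrable.
Context {disp : measure_display} {T : measurableType disp} {R : realType}.
Variables (mu : {measure set T -> \bar R}) (D : set T).
Hypothesis mD : measurable D.
Implicit Types f g h : T -> R.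

Local Notation intble f := (mu.-integrable D (EFin \o f)).

Lemma integrable_ae_le f g : measurable_fun D f -> intble g ->
  {ae mu, forall x, D x -> `|f x| <= g x} -> intble f.
Proof.
move=> mf ig fg; apply/integrableP; split; first exact/measurable_EFinP.
have [mg goo] := integrableP _ _ _ ig.
apply: le_lt_trans goo; apply: ae_ge0_le_integral => //.
- by apply/measurable_EFinP; apply: measurableT_comp.
- exact: measurableT_comp.
- by apply: filterS fg => x H Dx; rewrite /= lee_fin (le_trans (H Dx))// ler_norm.
Qed.

Lemma integrable_measurable f : intble f -> measurable_fun D f.
Proof. by move=> /integrableP[/measurable_EFinP]. Qed.

Lemma integrableDr f g : intble f -> intble g -> intble (fun x => f x + g x).
Proof. by move=> i j; have := integrableD mD i j. Qed.

Lemma integrableBr f g : intble f -> intble g -> intble (fun x => f x - g x).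
Proof. by move=> i j; have := integrableB mD i j. Qed.

Lemma integrableZr_l (c : R) f : intble f -> intble (fun x => c * f x).
Proof. by move=> i; have := integrableZl mD c i. Qed.

Lemma integrable_sumr (I : Type) (s : seq I) (h : I -> T -> R) :
  (forall i, intble (h i)) -> intble (fun x => \sum_(i <- s) h i x).
Proof.
move=> ih; have := @integrable_sum _ _ _ mu D mD I s xpredT
  (fun i => EFin \o h i) (fun i _ => ih i).
by apply: eq_integrable => // x _; rewrite /= -sumEFin.
Qed.

Lemma Rintegral_sum (I : Type) (s : seq I) (h : I -> T -> R) :
  (forall i, intble (h i)) ->
  \int[mu]_(x in D) (\sum_(i <- s) h i x) =
  \sum_(i <- s) \int[mu]_(x in D) h i x.
Proof.
move=> ih; elim: s => [|i s IH].
  under eq_Rintegral do rewrite big_nil.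
  by rewrite big_nil Rintegral_cst// mul0r.
under eq_Rintegral do rewrite big_cons.
by rewrite RintegralD//; [rewrite big_cons IH|exact: integrable_sumr].
Qed.

Lemma ae_eq_Rintegral f g : measurable_fun D f -> measurable_fun D g ->
  {ae mu, forall x, D x -> f x = g x} ->
  \int[mu]_(x in D) f x = \int[mu]_(x in D) g x.
Proof.
move=> mf mg fg; congr fine; apply: ae_eq_integral => //.
- exact/measurable_EFinP.
- exact/measurable_EFinP.
- by apply: filterS fg => x H Dx /=; rewrite H.
Qed.

Lemma ae_ge0_Rintegral f : measurable_fun D f ->
  {ae mu, forall x, D x -> 0 <= f x} -> 0 <= \int[mu]_(x in D) f x.
Proof.
move=> mf f0.
have -> : \int[mu]_(x in D) f x = \int[mu]_(x in D) `|f x|.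
  apply: ae_eq_Rintegral => //; first exact: measurableT_comp.
  by apply: filterS f0 => x H Dx; rewrite ger0_norm// H.
exact: Rintegral_ge0.
Qed.

Lemma ae_le_Rintegral f g : intble f -> intble g ->
  {ae mu, forall x, D x -> f x <= g x} ->
  \int[mu]_(x in D) f x <= \int[mu]_(x in D) g x.
Proof.
move=> fi gi fg; rewrite -subr_ge0 -RintegralB//.
apply: ae_ge0_Rintegral; first exact/integrable_measurable/integrableBr.
by apply: filterS fg => x H Dx; rewrite subr_ge0 H.
Qed.

(** Phrased with [integrable] rather than with a finite integral, so that the linearity lemmas for
    [Rintegral] apply directly; [in_L2_sqint] identifies it with [in_L2]. *)
Definition sqint f := measurable_fun D f /\ intble (fun x => f x ^+ 2).

Lemma sqint_measurable f : sqint f -> measurable_fun D f. Proof. by case. Qed.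

Lemma sqintM_integrable f g : sqint f -> sqint g -> intble (fun x => f x * g x).
Proof.
move=> [mf i2f] [mg i2g].
apply: (integrable_ae_le _ (integrableDr i2f i2g)).
  exact: measurable_funM.
apply: aeW => x _; rewrite normrM -(real_normK (num_real (f x))).
by rewrite -(real_normK (num_real (g x))); nra.
Qed.

Lemma sqintD f g : sqint f -> sqint g -> sqint (fun x => f x + g x).
Proof.
move=> f2 g2; split; first by apply: measurable_funD; apply: sqint_measurable.
have -> : (fun x => (f x + g x) ^+ 2) =
  (fun x => (f x ^+ 2 + 2 * (f x * g x)) + g x ^+ 2).
  by apply/funext => x; ring.
apply: integrableDr; last exact: g2.2.
apply: integrableDr; first exact: f2.2.
exact/integrableZr_l/sqintM_integrable.
Qed.

Lemma sqintZ (c : R) f : sqint f -> sqint (fun x => c * f x).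
Proof.
move=> f2; split; first by apply: measurable_funM => //; exact: f2.1.
have -> : (fun x => (c * f x) ^+ 2) = (fun x => c ^+ 2 * f x ^+ 2).
  by apply/funext => x; rewrite exprMn.
exact: (integrableZr_l _ f2.2).
Qed.

Lemma sqintB f g : sqint f -> sqint g -> sqint (fun x => f x - g x).
Proof.
move=> f2 /(sqintZ (-1)) g2; have := sqintD f2 g2.
by congr sqint; apply/funext => x; rewrite mulN1r.
Qed.

Lemma sqint0 : sqint (fun=> 0).
Proof.
split=> //; rewrite expr0n /=; exact: integrable0.
Qed.

Lemma sqint_sum (I : Type) (s : seq I) (h : I -> T -> R) :
  (forall i, sqint (h i)) -> sqint (fun x => \sum_(i <- s) h i x).
Proof.
move=> ih; elim: s => [|i s IH].
  by under eq_fun do rewrite big_nil; exact: sqint0.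
by under eq_fun do rewrite big_cons; exact: sqintD.
Qed.

Lemma integrable_cstr (c : R) : (mu D < +oo)%E -> intble (fun=> c).
Proof.
move=> Doo; apply/integrableP; split; first exact: measurable_cst.
rewrite [X in (X < _)%E](_ : _ = (`|c|%:E * mu D)%E); last exact: integral_cst.
by rewrite lte_mul_pinfty.
Qed.

Lemma sqint_cst (c : R) : (mu D < +oo)%E -> sqint (fun=> c).
Proof. by move=> Doo; split=> //; exact: integrable_cstr. Qed.

Lemma sqint_bounded (C : R) h g : measurable_fun D h ->
  {ae mu, forall x, D x -> `|h x| <= C} -> sqint g ->
  sqint (fun x => h x * g x).
Proof.
move=> mh hC g2; split; first by apply: measurable_funM => //; exact: g2.1.
apply: (integrable_ae_le _ (integrableZr_l (C ^+ 2) g2.2)).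
  by apply: measurable_funX; apply: measurable_funM => //; exact: g2.1.
apply: filterS hC => x /[apply] hC.
rewrite normrX normrM exprMn -(real_normK (num_real (g x))).
by rewrite ler_wpM2r ?exprn_ge0// ler_sqr ?nnegrE// (le_trans _ hC).
Qed.

Lemma bounded_integrable (C : R) h : (mu D < +oo)%E -> measurable_fun D h ->
  {ae mu, forall x, D x -> `|h x| <= C} -> intble h.
Proof.
move=> Doo mh hC; apply: (integrable_ae_le mh _ hC).
exact: integrable_cstr.
Qed.

Lemma sqint_integrable f : (mu D < +oo)%E -> sqint f -> intble f.
Proof.
move=> Doo f2; have := sqintM_integrable f2 (sqint_cst 1 Doo).
by congr (mu.-integrable D); apply/funext => x /=; rewrite mulr1.
Qed.

Lemma ge0_Rintegral_fineK f : (forall x, D x -> 0 <= f x) -> intble f ->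
  (\int[mu]_(x in D) (f x)%:E)%E = (\int[mu]_(x in D) f x)%:E.
Proof. by move=> f0 fi; rewrite fineK//; exact: integrable_fin_num. Qed.

End square_integrable.

(** * Lebesgue measure on R^n *)

Section rect.
Context {R : realType}.
Local Notation mu n := (@lebesgue_rV R n).

Definition rect n (I : 'I_n -> set R) : set 'rV[R]_n :=
  [set y | forall i, I i (y ord0 i)].

Lemma measurable_coord_preimage n (i : 'I_n) (B : set R) : measurable B ->
  measurable [set y : 'rV[R]_n | B (y ord0 i)].
Proof. by move=> mB; rewrite -[X in measurable X]setTI; exact: measurable_coord. Qed.

Lemma measurable_rect n (I : 'I_n -> set R) :
  (forall i, measurable (I i)) -> measurable (rect I).
Proof.
move=> mI; rewrite (_ : rect I = \bigcap_(i in [set: 'I_n]) [set y | I i (y ord0 i)]).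
  by apply: fin_bigcap_measurable => // i _; exact: measurable_coord_preimage.
by apply/seteqP; split => [y Iy i _|y Iy i]; exact: Iy.
Qed.

Lemma cons_rV0 n (p : measurableTypeR R * 'rV[R]_n) : cons_rV p ord0 ord0 = p.1.
Proof.
have -> : ord0 = lshift n ord0 :> 'I_(1 + n) by apply/val_inj.
by apply: etrans (row_mxEl _ _ _ _) _; rewrite mxE.
Qed.

Lemma cons_rVS n (p : measurableTypeR R * 'rV[R]_n) (i : 'I_n) :
  cons_rV p ord0 (lift ord0 i) = p.2 ord0 i.
Proof.
have -> : lift ord0 i = rshift 1 i :> 'I_(1 + n) by apply/val_inj.
exact: row_mxEr.
Qed.

Lemma lebesgue_rVS n (A : set 'rV[R]_n.+1) :
  mu n.+1 A = (lebesgue_measure \x mu n)%E (@cons_rV R n @^-1` A).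
Proof. by []. Qed.

Lemma lebesgue_rect n (I : 'I_n -> set R) :
  (forall i, measurable (I i)) -> (forall i, (lebesgue_measure (I i) < +oo)%E) ->
  mu n (rect I) = (\prod_i fine (lebesgue_measure (I i)))%:E.
Proof.
elim: n I => [|n IH] I mI Ioo.
  rewrite big_ord0 /= diracE mem_set//; by case.
have E : @cons_rV R n @^-1` rect I = I ord0 `*` rect (fun i => I (lift ord0 i)).
  apply/seteqP; split => p /=.
    move=> Ip; split => /=; first by have := Ip ord0; rewrite cons_rV0.
    by move=> i; have := Ip (lift ord0 i); rewrite cons_rVS.
  move=> [/= I0 IS] i; have [j ->|->] := unliftP ord0 i.
    by rewrite cons_rVS; exact: IS.
  by rewrite cons_rV0.
rewrite lebesgue_rVS E.
transitivity (lebesgue_measure (I ord0) *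
  mu n (rect (fun i => I (lift ord0 i))))%E.
  exact: (@product_measure1E _ _ _ _ R lebesgue_measure (mu n) (I ord0)
    (rect (fun i => I (lift ord0 i))) (mI _) (measurable_rect (fun i => mI _))).
rewrite (IH (fun i => I (lift ord0 i)))// big_ord_recl EFinM fineK//.
by rewrite ge0_fin_numE.
Qed.

(** Uniqueness of Lebesgue measure: its pushforward under a translation agrees with it on half-open
    intervals. *)
Lemma lebesgue_translation (h : R) (A : set R) : measurable A ->
  lebesgue_measure ((fun x => x + h) @^-1` A) = lebesgue_measure A.
Proof.
move=> mA; apply/esym.
have ms : measurable_fun setT (fun x : measurableTypeR R => x + h : measurableTypeR R).
  exact: measurable_funD.
(* Bundled as a measurable function, the translation makes its pushforward a measure. *)
pose m' := (isMeasurableFun.Build _ _ _ _ _ ms).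
pose g : {mfun measurableTypeR R >-> measurableTypeR R} :=
  HB.pack (fun x : measurableTypeR R => x + h : measurableTypeR R) m'.
apply: (@lebesgue_measure_unique R (pushforward (@lebesgue_measure R) g)) => //.
move=> X [[a b] /= _ <-]; rewrite /pushforward.
rewrite (_ : _ @^-1` _ = `]a - h, b - h]%classic); last first.
  by apply/seteqP; split => x /=; rewrite !in_itv/= ltrBlDr lerBrDr.
by rewrite !lebesgue_measure_itv/= !lte_fin ltrD2r -!EFinB opprD addrACA subrr addr0.
Qed.

Lemma ge0_integral_translation1 (h : R) (f : R -> \bar R) :
  measurable_fun setT f -> (forall x, 0 <= f x)%E ->
  (\int[@lebesgue_measure R]_x f (x + h)%R = \int[@lebesgue_measure R]_x f x)%E.
Proof.
move=> mf f0.
have ms : measurable_fun setT (fun x : measurableTypeR R => x + h : measurableTypeR R).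
  exact: measurable_funD.
have := @ge0_integral_pushforward _ _ _ _ _ _ ms (@lebesgue_measure R) setT f
  measurableT mf (fun x _ => f0 x).
rewrite preimage_setT /comp => <-.
by apply: eq_measure_integral => A mA _; exact: lebesgue_translation.
Qed.

Lemma cons_rVD n (x y : R) (u v : 'rV[R]_n) :
  cons_rV (x + y, u + v) = cons_rV (x, u) + cons_rV (y, v).
Proof.
apply/rowP => i; have [j ->|->] := unliftP ord0 i.
  by rewrite [in RHS]mxE !cons_rVS mxE.
by rewrite [in RHS]mxE !cons_rV0.
Qed.

(** Induction on the dimension: the measure is an iterated integral, the induction hypothesis
    handles the sections and the one-dimensional case the outer integral. *)
Lemma lebesgue_rV_translation n (h : 'rV[R]_n) (A : set 'rV[R]_n) :
  measurable A -> mu n ((fun y => y + h) @^-1` A) = mu n A.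
Proof.
elim: n h A => [|n IH] h A mA.
  rewrite (_ : _ @^-1` A = A)//; apply/seteqP; split => y /=;
    by rewrite (_ : y + h = y)//; apply/rowP; case.
pose h0 := h ord0 ord0; pose h' : 'rV[R]_n := \row_i h ord0 (lift ord0 i).
have hE : h = cons_rV (h0, h').
  apply/rowP => i; have [j ->|->] := unliftP ord0 i.
    by rewrite cons_rVS mxE.
  by rewrite cons_rV0.
rewrite !lebesgue_rVS.
set B := @cons_rV R n @^-1` A.
have mB : measurable B.
  by rewrite -[X in measurable X]setTI; exact: measurable_cons_rV.
rewrite /product_measure1.
(* The section at x of the translated set is the section of [A] at x + h0, translated by h'. *)
transitivity (\int[@lebesgue_measure R]_x (mu n (xsection B (x + h0)%R)))%E.
  apply: eq_integral => x _ /=.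
  rewrite -[RHS](IH h'); last exact: measurable_xsection.
  congr (lebesgue_rV n _).
  apply/seteqP; split => y.
    by rewrite /xsection/= !inE /B/= cons_rVD -hE.
  by rewrite /xsection/= !inE /B/= cons_rVD -hE.
apply: (ge0_integral_translation1 h0 (f := fun x => mu n (xsection B x))) => //.
exact: measurable_fun_xsection.
Qed.

Lemma measurable_translation n (h : 'rV[R]_n) :
  measurable_fun setT (fun y : 'rV[R]_n => y + h).
Proof.
apply: measurable_fun_coord => i.
under eq_fun do rewrite mxE.
by apply: measurable_funD => //; exact: measurable_coord.
Qed.

Lemma ge0_integral_translation n (h : 'rV[R]_n) (D : set 'rV[R]_n)
    (f : 'rV[R]_n -> \bar R) :
  measurable D -> measurable_fun D f -> (forall x, 0 <= f x)%E ->
  (\int[mu n]_(x in (fun y => y + h)%R @^-1` D) f (x + h)%R = \int[mu n]_(x in D) f x)%E.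
Proof.
move=> mD mf f0.
have := @ge0_integral_pushforward _ _ _ _ _ _ (measurable_translation h) (mu n) D f
  mD mf (fun x _ => f0 x).
rewrite /comp => <-.
apply: eq_measure_integral; first exact: measurable_translation.
by move=> ? A mA _; exact: lebesgue_rV_translation.
Qed.

Lemma Rintegral_translation n (h : 'rV[R]_n) (D : set 'rV[R]_n)
    (f : 'rV[R]_n -> R) :
  measurable D -> measurable_fun D f ->
  \int[mu n]_(x in (fun y => y + h) @^-1` D) f (x + h) = \int[mu n]_(x in D) f x.
Proof.
move=> mD mf; congr fine; rewrite integralE [RHS]integralE.
have mf' : measurable_fun D (EFin \o f) by exact/measurable_EFinP.
congr (_ - _)%E.
  have := ge0_integral_translation h mD (measurable_funepos mf')
    (fun x => funepos_ge0 _ x).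
  by move=> <-; apply: eq_integral => x _; rewrite !funeposE.
have := ge0_integral_translation h mD (measurable_funeneg mf')
  (fun x => funeneg_ge0 _ x).
by move=> <-; apply: eq_integral => x _; rewrite !funenegE.
Qed.

Lemma ae_translation n (h : 'rV[R]_n) (Q : 'rV[R]_n -> Prop) :
  {ae mu n, forall x, Q x} -> {ae mu n, forall x, Q (x + h)}.
Proof.
move=> [N [mN N0 QN]]; exists ((fun y => y + h) @^-1` N); split.
- by rewrite -[X in measurable X]setTI; exact: measurable_translation.
- by rewrite lebesgue_rV_translation.
- by move=> x /= Qx; exact: QN.
Qed.

Lemma measurable_fun_translation n (h : 'rV[R]_n) (D : set 'rV[R]_n)
    (f : 'rV[R]_n -> R) : measurable D -> measurable_fun D f ->
  measurable_fun ((fun y => y + h) @^-1` D) (fun x => f (x + h)).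
Proof.
move=> mD mf _ Y mY; have := mf mD Y mY => mDY.
rewrite (_ : _ `&` _ = (fun y => y + h) @^-1` (D `&` f @^-1` Y))//.
by rewrite -[X in measurable X]setTI; exact: measurable_translation.
Qed.

End rect.

Lemma rV_coord_bound {R : realType} {n : nat} (y : 'rV[R]_n) :
  exists m : nat, forall j, `|y ord0 j| < m%:R.
Proof.
exists (Num.truncn (\sum_j `|y ord0 j|)).+1 => j.
by apply: le_lt_trans (truncnS_gt _); rewrite (bigD1 j)//= lerDl sumr_ge0.
Qed.

(** * Open sets, boxes and Lebesgue measure *)

Section topology_rV.
Context {R : realType} {n : nat}.
Local Notation mu := (@lebesgue_rV R n).

Definition obox (a b : 'rV[R]_n) : set 'rV[R]_n :=
  rect (fun i => `]a ord0 i, b ord0 i[%classic).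

Lemma measurable_obox a b : measurable (obox a b).
Proof. by apply: measurable_rect => i; exact: measurable_itv. Qed.

Lemma ball_rV (x y : 'rV[R]_n) (e : R) : 0 < e ->
  ball x e y <-> forall i, `|x ord0 i - y ord0 i| < e.
Proof.
move=> e0; split => [[_ H] i|H]; first exact: H.
by split => // i j; rewrite (ord1 i); exact: H.
Qed.

Lemma open_ballP (D : set 'rV[R]_n) (x : 'rV[R]_n) : open D -> D x ->
  exists2 e : R, 0 < e & forall y : 'rV[R]_n, (forall i, `|x ord0 i - y ord0 i| < e) -> D y.
Proof.
move=> oD Dx; have /nbhs_ballP[e /= e0 He] := open_nbhs_nbhs (conj oD Dx).
by exists e => // y xy; apply: He; apply/ball_rV.
Qed.

Lemma open_oboxP (D : set 'rV[R]_n) (x : 'rV[R]_n) : open D -> D x ->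
  exists2 e : R, 0 < e & obox (x - const_mx e) (x + const_mx e) `<=` D.
Proof.
move=> oD Dx; have [e e0 He] := open_ballP oD Dx; exists e => // y yb.
apply: He => i; have := yb i; rewrite /= !mxE in_itv/= => /andP[? ?].
rewrite ltr_norml; lra.
Qed.

(** The sigma-algebra is generated by the coordinates, so an open set has to be written as a
    countable union of boxes with rational centre and radius. *)
Lemma open_measurable_rV (D : set 'rV[R]_n) : open D -> measurable D.
Proof.
move=> oD.
pose B (q : 'rV[rat]_n * rat) : set 'rV[R]_n :=
  obox (map_mx ratr q.1 - const_mx (ratr q.2)) (map_mx ratr q.1 + const_mx (ratr q.2)).
rewrite (_ : D = \bigcup_q (if `[< B q `<=` D >] then B q else set0)).
  apply: countable_bigcupT_measurable => // q.
  by case: ifP => // _; exact: measurable_obox.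
apply/seteqP; split => [x Dx|x [q _]]; last by case: asboolP => // + Bq; apply.
have [e e0 He] := open_ballP oD Dx.
(* With a rational radius r < e / 2 and a rational centre closer than r to x, the box contains x and
   stays within 2 r < e of it. *)
have [r] := @rat_in_itvoo R 0 (e / 2) ltac:(lra); rewrite in_itv/= => /andP[r0 re].
have /choice[q Hq] : forall i, exists q : rat,
    ratr q \in `](x ord0 i - ratr r), (x ord0 i + ratr r)[.
  by move=> i; apply: rat_in_itvoo; lra.
exists (\row_i q i, r) => //; case: asboolP => [_|].
  by move=> i; have := Hq i; rewrite /= !mxE !in_itv/= => /andP[? ?]; lra.
case=> y By; apply: He => i; have := By i; have := Hq i.
rewrite /= !mxE !in_itv/= => /andP[? ?] /andP[? ?].
by rewrite ltr_norml; lra.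
Qed.

Lemma continuous_measurable_rV (D : set 'rV[R]_n) (f : 'rV[R]_n -> R) :
  continuous f -> measurable_fun D f.
Proof.
move=> cf; apply: (@measurable_funS _ _ _ _ setT) => //.
apply: (measurability _ (RGenOpens.measurableE R)).
move=> _ [_ [a [b ->] <-]]; rewrite setTI; apply: open_measurable_rV.
by apply: open_comp; [move=> x _; exact: cf|exact: interval_open].
Qed.

Lemma lebesgue_obox (a b : 'rV[R]_n) : (forall i, a ord0 i < b ord0 i) ->
  mu (obox a b) = (\prod_i (b ord0 i - a ord0 i))%:E.
Proof.
move=> ab; rewrite lebesgue_rect.
- congr EFin; apply: eq_bigr => i _.
  by rewrite lebesgue_measure_itv/= lte_fin ab -EFinB.
- by move=> i; exact: measurable_itv.
- by move=> i; rewrite lebesgue_measure_itv/= lte_fin ab -EFinB ltry.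
Qed.

Lemma bounded_oboxP (D : set 'rV[R]_n) : bounded_set D ->
  exists2 L : R, 0 < L & D `<=` obox (const_mx (- L)) (const_mx L).
Proof.
(* [bounded_set] provides every bound strictly above M, here max(M, 0) + 1; one more unit makes the
   inequalities of the open box strict. *)
move=> [M [Mreal HM]]; exists (Num.max M 0 + 2).
  have : 0 <= Num.max M 0 by rewrite le_max lexx orbT.
  lra.
move=> y Dy i.
have yn : `|y| <= Num.max M 0 + 1.
  by apply: HM => //; rewrite (@le_lt_trans _ _ (Num.max M 0)) ?le_max ?lexx// ltrDl.
have yi : `|y ord0 i| <= `|y|.
  rewrite [leRHS]/Num.norm /= mx_normrE; apply/bigmax_geP; right => /=.
  by exists (ord0, i).
by rewrite /= !mxE in_itv/= -ltr_norml (le_lt_trans yi)// (le_lt_trans yn)//; lra.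
Qed.

Lemma lebesgue_bounded (D : set 'rV[R]_n) : measurable D -> bounded_set D ->
  (mu D < +oo)%E.
Proof.
move=> mD /bounded_oboxP[L L0 DL].
apply: (@le_lt_trans _ _ (mu (obox (const_mx (- L)) (const_mx L)))).
  by apply: le_measure; rewrite ?inE//; exact: measurable_obox.
by rewrite lebesgue_obox ?ltry// => i; rewrite !mxE; lra.
Qed.

Lemma lebesgue_open_gt0 (D : set 'rV[R]_n) : open D -> D !=set0 -> (0 < mu D)%E.
Proof.
move=> oD [x Dx]; have [e e0 eD] := open_oboxP oD Dx.
apply: (@lt_le_trans _ _ (mu (obox (x - const_mx e) (x + const_mx e)))).
  rewrite lebesgue_obox => [|i]; last by rewrite !mxE; lra.
  by rewrite lte_fin; apply: prodr_gt0 => i _; rewrite !mxE; lra.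
apply: le_measure; rewrite ?inE//; first exact: measurable_obox.
exact: open_measurable_rV.
Qed.

Lemma lebesgue_setT_gt0 : (0 < mu setT)%E.
Proof. by apply: lebesgue_open_gt0; [exact: openT|exists 0]. Qed.

Lemma open_obox a b : open (obox a b).
Proof.
rewrite openE => x bx; exists (fun _ i => `]a ord0 i, b ord0 i[%classic).
  move=> i j; rewrite (ord1 i); apply: open_nbhs_nbhs; split.
    exact: interval_open.
  exact: bx.
by move=> y yb i; exact: yb.
Qed.

Lemma bounded_obox a b : bounded_set (obox a b).
Proof.
pose K := \sum_i (`|a ord0 i| + `|b ord0 i|).
exists K; split; first exact: num_real.
move=> M KM y yb /=.
rewrite [leLHS]/Num.norm /= mx_normrE; apply/bigmax_leP; split.
  by apply: le_trans (ltW KM); apply: sumr_ge0 => i _; rewrite addr_ge0.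
move=> [i0 i] _ /=; rewrite ord1; have := yb i; rewrite /= in_itv/= => /andP[ya yb'].
apply: le_trans (ltW KM).
apply: (@le_trans _ _ (`|a ord0 i| + `|b ord0 i|)).
  have := ler_norm (b ord0 i); have := ler_norm (- a ord0 i); rewrite normrN.
  by have := normr_ge0 (b ord0 i); have := normr_ge0 (a ord0 i); rewrite ler_norml; lra.
rewrite /K (bigD1 i)//= lerDl; apply: sumr_ge0 => j _; by rewrite addr_ge0.
Qed.

End topology_rV.

(** * Smooth cut-offs of boxes *)

Section flat_functions.
Context {R : realType}.
Implicit Types (p : {poly R}) (t x : R).

(** The classical flat function exp(-1/t), with a polynomial in 1/t as a factor: this family is
    closed under differentiation. *)
Definition flat p t : R := if 0 < t then p.[t^-1] * expR (- t^-1) else 0.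

Lemma flat_le0 p t : t <= 0 -> flat p t = 0.
Proof. by rewrite /flat ltNge => ->. Qed.

(** The power x^k is there for the induction on p: the product p X + c passes its factor X on to the
    power. *)
Lemma horner_expR_bound p k :
  exists C : R, forall x, 0 <= x -> `|p.[x] * x ^+ k * expR (- x)| <= C.
Proof.
elim/poly_ind: p k => [|p c IH] k.
  by exists 0 => x _; rewrite horner0 !mul0r normr0.
have [C HC] := IH k.+1; exists (C + `|c| * k`!%:R) => x x0.
rewrite hornerMXaddC.
have -> : (p.[x] * x + c) * x ^+ k * expR (- x) =
  p.[x] * x ^+ k.+1 * expR (- x) + c * (x ^+ k * expR (- x)) by rewrite exprS; ring.
apply: le_trans (ler_normD _ _) _; apply: lerD; first exact: HC.
rewrite normrM ler_wpM2l// ger0_norm ?mulr_ge0 ?exprn_ge0 ?expR_ge0//.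
rewrite expRN ler_pdivrMr ?expR_gt0//.
case: k {HC} => [|k]; last first.
  have := expR_ge1Dxn k x0; have f0 : (0 : R) < (k.+1)`!%:R by rewrite ltr0n fact_gt0.
  move=> H; rewrite -ler_pdivrMl// mulrC; lra.
by rewrite expr0 fact0 mul1r; have := expR_ge1Dx x; lra.
Qed.

(** A quadratic bound at 0 makes the difference quotients there tend to 0. *)
Lemma flat_le_sqr p : exists C : R, forall t, `|flat p t| <= C * t ^+ 2.
Proof.
have [C HC] := horner_expR_bound p 2; exists C => t; rewrite /flat.
have C0 : 0 <= C by apply: le_trans (HC 0 _) => //.
case: ifPn => [t0|_]; last by rewrite normr0 mulr_ge0// sqr_ge0.
have := HC t^-1; rewrite invr_ge0 => /(_ (ltW t0)).
have -> : p.[t^-1] * t^-1 ^+ 2 * expR (- t^-1) =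
  (p.[t^-1] * expR (- t^-1)) / t ^+ 2 by rewrite exprVn; ring.
by rewrite normrM normfV (ger0_norm (sqr_ge0 _)) ler_pdivrMr// exprn_gt0.
Qed.

Lemma is_derive_flat p t : is_derive t 1 (flat p) (flat ('X^2 * (p - p^`())) t).
Proof.
have [t0|t0|<-] := ltrgtP 0 t.
- have tn0 : t != 0 by rewrite gt_eqF.
  have E : \near t, (fun s => p.[s^-1] * expR (- s^-1)) t = flat p t.
    have : \forall s \near t, 0 < s by apply: lt_nbhsr.
    by apply: filterS => s s0; rewrite /flat s0.
  apply: (near_eq_is_derive E).
  rewrite /flat t0 !hornerE.
  have dV : is_derive t 1 (fun s : R => s^-1) (- t ^- 2 *: 1) by apply: is_deriveV.
  have d1 : is_derive t 1 (fun s : R => p.[s^-1]) (p^`().[t^-1] * (- t ^- 2 *: 1)).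
    exact: (is_derive1_comp (is_derive_poly p t^-1) dV).
  have d2 : is_derive t 1 (fun s : R => expR (- s^-1))
      (expR (- t^-1) * - (- t ^- 2 *: 1)).
    have dN : is_derive t 1 (fun s : R => - s^-1) (- (- t ^- 2 *: 1)).
      exact: is_deriveN.
    exact: (@is_derive1_comp _ expR (fun s => - s^-1) t _ _ (is_derive_expR _) dN).
  have d3 := is_deriveM d1 d2.
  apply: (is_derive_eq d3).
  rewrite /GRing.scale/= mulr1 -!exprVn; ring.
- have E : \near t, cst 0 t = flat p t.
    have : \forall s \near t, s < 0 by apply: lt_nbhsl.
    by apply: filterS => s s0; rewrite /flat ltNge (ltW s0).
  apply: (near_eq_is_derive E).
  by rewrite /flat ltNge (ltW t0)/=; exact: is_derive_cst.
(* At 0 the slope function is flat(s) / s, whose value at s = 0 is 0 because the inverse of 0 is 0;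
   [flat_le_sqr] gives its continuity. *)
- rewrite (flat_le0 _ (lexx 0)); apply/is_derive1_caratheodory.
  exists (fun s => flat p s / s); split.
  + move=> s; rewrite subr0 (flat_le0 _ (lexx 0)) subr0.
    by have [->|s0] := eqVneq s 0; [rewrite mulr0 flat_le0|rewrite divfK].
  + have [C HC] := flat_le_sqr p.
    rewrite /prop_for /continuous_at /= invr0 mulr0; apply/cvgr0Pnorm_le => e e0.
    have C0 : 0 <= C by have := HC 1; rewrite expr1n mulr1; exact: le_trans.
    have C1 : 0 < C + 1 by lra.
    near=> s; have [->|s0] := eqVneq s 0; first by rewrite invr0 mulr0 normr0 ltW.
    rewrite normrM normfV ler_pdivrMr ?normr_gt0//.
    apply: le_trans (HC s) _; rewrite -(real_normK (num_real s)) expr2 mulrA.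
    rewrite ler_wpM2r//.
    have : `|s| <= e / (C + 1).
      near: s; by apply: (@nbhs0_le R R^o); rewrite divr_gt0.
    rewrite ler_pdivlMr// => H; apply: le_trans H; rewrite mulrC ler_wpM2l//; lra.
  + by rewrite invr0 mulr0.
Unshelve. all: by end_near. Qed.

(** A syntactic class closed under differentiation: computing one derivative for each constructor
    then yields derivatives of all orders. *)
Inductive smooth1 : (R -> R) -> Prop :=
| smooth1_flat p : smooth1 (flat p)
| smooth1_cst c : smooth1 (fun=> c)
| smooth1_id : smooth1 (fun t => t)
| smooth1D f g : smooth1 f -> smooth1 g -> smooth1 (fun t => f t + g t)
| smooth1M f g : smooth1 f -> smooth1 g -> smooth1 (fun t => f t * g t)
| smooth1_affine a b f : smooth1 f -> smooth1 (fun t => f (a * t + b))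
| smooth1V f : smooth1 f -> (forall t, f t != 0) -> smooth1 (fun t => (f t)^-1).

Lemma smooth1_derive f : smooth1 f ->
  exists g, smooth1 g /\ forall t, is_derive t 1 f (g t).
Proof.
elim=> {f} [p|c||f g _ [f' [sf' df]] _ [g' [sg' dg]]
  |f g sf [f' [sf' df]] sg [g' [sg' dg]]|a b f _ [f' [sf' df]]|f sf [f' [sf' df]] f0].
- by exists (flat ('X^2 * (p - p^`()))); split; [constructor|exact: is_derive_flat].
- by exists (fun=> 0); split; [constructor|move=> t; exact: is_derive_cst].
- by exists (fun=> 1); split; [constructor|move=> t; exact: is_derive_id].
- exists (fun t => f' t + g' t); split; first exact: smooth1D.
  by move=> t; exact: (is_deriveD (df t) (dg t)).
- exists (fun t => f t * g' t + g t * f' t); split.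
    by apply: smooth1D; exact: smooth1M.
  by move=> t; exact: (is_deriveM (df t) (dg t)).
- exists (fun t => a * f' (a * t + b)); split.
    by apply: smooth1M; [exact: smooth1_cst|exact: smooth1_affine].
  move=> t.
  have d1 : is_derive t 1 (fun t => a * t + b) a.
    have d0 : is_derive t 1 (fun t => a * t + b) (a *: (1 : R) + 0).
      exact: (is_deriveD (is_deriveZ a (is_derive_id t 1)) (is_derive_cst b t 1)).
    by apply: is_derive_eq d0 _; rewrite addr0 /GRing.scale/= mulr1.
  have := @is_derive1_comp _ f (fun t => a * t + b) t _ _ (df (a * t + b)) d1.
  by rewrite mulrC.
- exists (fun t => - (f t)^-1 * (f t)^-1 * f' t); split.
    apply: smooth1M => //; apply: smooth1M; last exact: smooth1V.
    have -> : (fun t => - (f t)^-1) = (fun t => -1 * (f t)^-1).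
      by apply/funext => t; rewrite mulN1r.
    by apply: smooth1M; [exact: smooth1_cst|exact: smooth1V].
  move=> t; have := is_deriveV (f0 t) (df t); congr is_derive.
  by rewrite /GRing.scale/= -exprVn expr2 !mulNr.
Qed.

Lemma smooth1_continuous f : smooth1 f -> continuous f.
Proof.
move=> /smooth1_derive[g [_ dfg]] t.
by apply/differentiable_continuous/derivable1_diffP; case: (dfg t).
Qed.

(** The usual smooth transition F(t) / (F(t) + F(1 - t)) from 0 on t <= 0 to 1 on t >= 1; 1 - t is
    written in the form that [smooth1_affine] accepts. *)
Definition step t : R := flat 1 t * (flat 1 t + flat 1 (-1 * t + 1))^-1.

Lemma flat1_ge0 t : 0 <= flat 1 t.
Proof. by rewrite /flat; case: ifP => // _; rewrite hornerC mul1r expR_ge0. Qed.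

Lemma flat1_gt0 t : 0 < t -> 0 < flat 1 t.
Proof. by rewrite /flat => ->; rewrite hornerC mul1r expR_gt0. Qed.

Lemma step_den_gt0 t : 0 < flat 1 t + flat 1 (-1 * t + 1).
Proof.
have [t0|t0] := ltP 0 t; first by rewrite ltr_pwDl ?flat1_gt0 ?flat1_ge0.
by rewrite ltr_wpDl ?flat1_ge0// flat1_gt0//; lra.
Qed.

Lemma smooth1_step : smooth1 step.
Proof.
apply: smooth1M; first exact: smooth1_flat.
apply: smooth1V; last by move=> t; rewrite gt_eqF// step_den_gt0.
by apply: smooth1D; [|apply: smooth1_affine]; exact: smooth1_flat.
Qed.

Lemma step_le0 t : t <= 0 -> step t = 0.
Proof. by move=> t0; rewrite /step flat_le0// mul0r. Qed.

Lemma step_ge1 t : 1 <= t -> step t = 1.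
Proof.
move=> t1; have := step_den_gt0 t; rewrite /step.
rewrite (@flat_le0 _ (-1 * t + 1)); last lra.
by rewrite addr0 => t0; rewrite divff// gt_eqF.
Qed.

Lemma step_itv t : 0 <= step t <= 1.
Proof.
rewrite /step divr_ge0 ?flat1_ge0 ?(ltW (step_den_gt0 _))//=.
by rewrite ler_pdivrMr ?step_den_gt0// mul1r lerDl flat1_ge0.
Qed.

End flat_functions.

Section smooth_rV.
Context {R : realType} {d : nat}.
Implicit Types f g : 'rV[R]_d -> R.

(** The analogue of [smooth1] in d variables, just rich enough for sums and products of functions of
    one coordinate. *)
Inductive smoothn : ('rV[R]_d -> R) -> Prop :=
| smoothn_coord i (f : R -> R) : smooth1 f -> smoothn (fun y => f (y ord0 i))
| smoothn_cst c : smoothn (fun=> c)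
| smoothnD f g : smoothn f -> smoothn g -> smoothn (fun y => f y + g y)
| smoothnM f g : smoothn f -> smoothn g -> smoothn (fun y => f y * g y).

Lemma is_derive_along0 f (x v : 'rV[R]_d) :
  (forall h : R, f (h *: v + x) = f x) -> is_derive x v f 0.
Proof.
move=> fx.
have E : (fun h : R => h^-1 *: ((f \o shift x) (h *: v) - f x)) = cst 0.
  by apply/funext => h /=; rewrite fx subrr scaler0.
split; first by rewrite /derivable E; exact: is_cvg_cst.
by rewrite /derive E; exact: lim_cst.
Qed.

Lemma is_derive_coord (f : R -> R) (i : 'I_d) (x : 'rV[R]_d) (a : R) :
  is_derive (x ord0 i) 1 f a ->
  is_derive x (basis_vec i) (fun y => f (y ord0 i)) a.
Proof.
move=> [df <-].
have E : (fun h : R => h^-1 *: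
    (((fun y => f (y ord0 i)) \o shift x) (h *: basis_vec i) - f (x ord0 i)))
   = (fun h => h^-1 *: ((f \o shift (x ord0 i)) (h *: 1) - f (x ord0 i))).
  by apply/funext => h /=; rewrite !mxE !eqxx.
by split; [rewrite /derivable E|rewrite /derive E].
Qed.

Lemma smoothn_derive f i : smoothn f ->
  exists g, smoothn g /\ forall x, is_derive x (basis_vec i) f (g x).
Proof.
elim=> {f} [j f sf|c|f g _ [f' [sf' df]] _ [g' [sg' dg]]
  |f g sf [f' [sf' df]] sg [g' [sg' dg]]].
- have [->|ij] := eqVneq j i.
    have [g [sg dg]] := smooth1_derive sf.
    exists (fun y => g (y ord0 i)); split; first exact: smoothn_coord.
    by move=> x; apply: is_derive_coord.
  exists (fun=> 0); split; first exact: smoothn_cst.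
  move=> x; apply: is_derive_along0 => h.
  by rewrite !mxE (negbTE ij) mulr0 add0r.
- by exists (fun=> 0); split; [exact: smoothn_cst|move=> t; exact: is_derive_cst].
- exists (fun t => f' t + g' t); split; first exact: smoothnD.
  by move=> t; exact: (is_deriveD (df t) (dg t)).
- exists (fun t => f t * g' t + g t * f' t); split.
    by apply: smoothnD; exact: smoothnM.
  by move=> t; exact: (is_deriveM (df t) (dg t)).
Qed.

Lemma smoothn_continuous f : smoothn f -> continuous f.
Proof.
elim=> {f} [j f sf|c|f g _ cf _ cg|f g _ cf _ cg] x.
- apply: (@continuous_comp _ _ _ (fun y : 'rV[R]_d => y ord0 j) f).
    exact: coord_continuous.
  exact: smooth1_continuous.
- exact: cst_continuous.
- exact: (continuousD (cf x) (cg x)).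
- exact: (continuousM (cf x) (cg x)).
Qed.

Lemma smoothn_smooth f : smoothn f -> smooth f.
Proof.
move=> sf n; elim: n f sf => [|n IH] f sf; first by split=> //; exact: smoothn_continuous.
split; first exact: smoothn_continuous.
move=> i; have [g [sg dg]] := smoothn_derive i sf.
split=> [x|]; first by case: (dg x).
have -> : (fun x => 'D_(basis_vec i) f x) = g.
  by apply/funext => x; case: (dg x).
exact: IH.
Qed.

Lemma smoothn_prod (I : Type) (s : seq I) (P : pred I) (F : I -> 'rV[R]_d -> R) :
  (forall i, smoothn (F i)) -> smoothn (fun y => \prod_(i <- s | P i) F i y).
Proof.
move=> sF; elim: s => [|i s IH].
  by under eq_fun do rewrite big_nil; exact: smoothn_cst.
under eq_fun do rewrite big_cons.
by case: (P i) => //; exact: smoothnM.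
Qed.

End smooth_rV.

Section cutoff.
Context {R : realType} {d : nat}.
Implicit Types (a b y : 'rV[R]_d) (t : R).

(** Half-open on the left because [step] vanishes at 0: the cut-offs then converge to the indicator
    at every point, faces included. Such boxes are also closed under intersection. *)
Definition hbox a b : set 'rV[R]_d :=
  rect (fun i => `]a ord0 i, b ord0 i]%classic).

(** A difference of two steps, at a and at b, whose transition layers [a, a + 1/(n+1)] and
    [b, b + 1/(n+1)] shrink as n grows. *)
Definition cut1 (n : nat) (a b t : R) : R :=
  step (n.+1%:R * (t - a)) - step (n.+1%:R * (t - b)).

Definition cutoff (n : nat) a b y : R :=
  \prod_i cut1 n (a ord0 i) (b ord0 i) (y ord0 i).

Lemma measurable_hbox a b : measurable (hbox a b).
Proof. by apply: measurable_rect => i; exact: measurable_itv. Qed.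

Lemma smooth1_step_affine (c a : R) : smooth1 (fun t : R => step (c * (t - a))).
Proof.
rewrite (_ : (fun t => _) = (fun t => step (c * t + (- (c * a))))); last first.
  by apply/funext => t; rewrite mulrBr.
exact/smooth1_affine/smooth1_step.
Qed.

Lemma smooth1_cut1 n (a b : R) : smooth1 (cut1 n a b).
Proof.
rewrite (_ : cut1 n a b = (fun t => step (n.+1%:R * (t - a)) +
  (-1) * step (n.+1%:R * (t - b)))); last first.
  by apply/funext => t; rewrite /cut1 mulN1r.
apply: smooth1D; first exact: smooth1_step_affine.
by apply: smooth1M; [exact: smooth1_cst|exact: smooth1_step_affine].
Qed.

Lemma smoothn_cutoff n a b : smoothn (cutoff n a b).
Proof. by apply: smoothn_prod => i; exact/smoothn_coord/smooth1_cut1. Qed.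

Lemma cut1_norm n (a b t : R) : `|cut1 n a b t| <= 1.
Proof.
have := step_itv (n.+1%:R * (t - a)); have := step_itv (n.+1%:R * (t - b)).
by rewrite /cut1 => /andP[? ?] /andP[? ?]; rewrite ler_norml; lra.
Qed.

Lemma cutoff_norm n a b y : `|cutoff n a b y| <= 1.
Proof.
by rewrite normr_prod; apply: prodr_ile1 => i _; rewrite normr_ge0 cut1_norm.
Qed.

Lemma step_scale_ge1 n (t : R) : 1 <= t -> step (n.+1%:R * t) = 1.
Proof.
move=> t1; apply: step_ge1; apply: (le_trans t1).
by apply: ler_peMl; [exact: le_trans t1|rewrite ler1n].
Qed.

Lemma step_scale_le0 n (t : R) : t <= 0 -> step (n.+1%:R * t) = 0.
Proof. by move=> t0; apply: step_le0; rewrite pmulr_rle0. Qed.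

Lemma cut1_out n (a b t : R) : a <= b -> cut1 n a b t != 0 -> a < t < b + 1.
Proof.
move=> ab; apply: contra_neqT; rewrite negb_and -!leNgt => /orP[ta|tb].
  by rewrite /cut1 !step_scale_le0 ?subrr//; lra.
by rewrite /cut1 !step_scale_ge1 ?subrr//; lra.
Qed.

Lemma near_step1 (t : R) : 0 < t -> \forall n \near \oo, step (n.+1%:R * t) = 1.
Proof.
move=> t0; near=> n; apply: step_ge1; rewrite -ler_pdivrMr// mul1r.
apply: (@le_trans _ _ n%:R); last by rewrite ler_nat.
by near: n; exact: nbhs_infty_ger.
Unshelve. all: by end_near. Qed.

(** At a fixed point the sequence is eventually constant, since the point leaves both transition
    layers. *)
Lemma cut1_near (a b t : R) : a <= b ->
  \forall n \near \oo, cut1 n a b t = (a < t <= b)%R%:R.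
Proof.
move=> ab; have [ta|ta] := leP t a.
  by near=> m; rewrite /cut1 !step_scale_le0 ?subrr//; lra.
have [tb|tb] := leP t b.
  near=> m; rewrite /cut1 (step_scale_le0 _ (t := t - b)) ?subr0; last lra.
  by near: m; apply: near_step1; lra.
near=> m; rewrite /cut1.
have -> : step (m.+1%:R * (t - a)) = 1 by near: m; apply: near_step1; lra.
have -> : step (m.+1%:R * (t - b)) = 1 by near: m; apply: near_step1; lra.
by rewrite subrr.
Unshelve. all: by end_near. Qed.

Lemma cutoff_cvg a b y : (forall i, a ord0 i <= b ord0 i) ->
  cutoff n a b y @[n --> \oo] --> (\1_(hbox a b) y : R).
Proof.
move=> ab; apply: cvg_near_cst.
have : \forall n \near \oo, forall i, cut1 n (a ord0 i) (b ord0 i) (y ord0 i) =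
    (a ord0 i < y ord0 i <= b ord0 i)%R%:R.
  by apply: filter_forall => i; exact: cut1_near.
apply: filterS => n H; rewrite /cutoff indicE.
under eq_bigr do rewrite H.
case: (boolP (y \in hbox a b)); rewrite ?inE ?notin_setE => yb.
  by rewrite big1// => i _; have := yb i; rewrite /= in_itv/= => ->.
have [i /negP Hi] : exists i, ~ (a ord0 i < y ord0 i <= b ord0 i).
  apply: contrapT => K; apply: yb => i; rewrite /= in_itv/=.
  by apply: contrapT => ?; apply: K; exists i.
by rewrite (bigD1 i)//= (negbTE Hi) mul0r.
Qed.

Lemma cutoff_translation n a b (h y : 'rV[R]_d) :
  cutoff n (a + h) (b + h) (y + h) = cutoff n a b y.
Proof.
apply: eq_bigr => i _; rewrite !mxE /cut1.
by congr (step (_ * _) - step (_ * _)); ring.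
Qed.

(** One bounded open box for all n: the supports lie in the product of the [a_i, b_i + 1], the
    layers having width at most 1. *)
Definition cutoff_nbhd a b := obox (a - const_mx 1) (b + const_mx 2).

Lemma cutoff_test n a b : (forall i, a ord0 i <= b ord0 i) ->
  test_function (cutoff_nbhd a b) (cutoff n a b).
Proof.
move=> ab.
pose K : set 'rV[R]_d := [set y | forall i, `[a ord0 i, b ord0 i + 1]%classic (y ord0 i)].
have cK : compact K.
  by apply: (@rV_compact _ _ (fun i => `[a ord0 i, b ord0 i + 1]%classic)) => i;
    exact: segment_compact.
have clK : closed K by apply: compact_closed => //; exact: norm_hausdorff.
have sK : closure [set x | cutoff n a b x != 0] `<=` K.
  rewrite [X in _ `<=` X](closure_id K).1//; apply: closureS.
  move=> y /= /prodf_neq0 y0 i; rewrite /= in_itv/=.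
  by have /andP[? ?] := cut1_out (ab i) (y0 i isT); apply/andP; split; lra.
split.
- exact/smoothn_smooth/smoothn_cutoff.
- by apply: subclosed_compact cK sK; exact: closed_closure.
- move=> y /sK Ky i; have := Ky i; rewrite /= !mxE !in_itv/= => /andP[? ?].
  by apply/andP; split; lra.
Qed.

End cutoff.

(** * Boxes as a pi-system *)

Section hbox_pi_system.
Context {R : realType} {d : nat}.
Implicit Types (a b y : 'rV[R]_d) (t : R).
Local Notation mu := (@lebesgue_rV R d).

Definition hboxes : set (set 'rV[R]_d) := [set E | exists a b, E = hbox a b].

Lemma hboxes_setI : setI_closed hboxes.
Proof.
move=> _ _ [a [b ->]] [a' [b' ->]].
exists (\row_i Num.max (a ord0 i) (a' ord0 i)), (\row_i Num.min (b ord0 i) (b' ord0 i)).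
apply/seteqP; split => y.
  move=> [Ha Hb] i; have := Ha i; have := Hb i; rewrite /= !in_itv/= !mxE.
  by move=> /andP[h1 h2] /andP[h3 h4]; rewrite gt_max le_min h1 h2 h3 h4.
move=> H; split => i; have := H i; rewrite /= !in_itv/= !mxE gt_max le_min;
  by move=> /andP[/andP[h1 h2] /andP[h3 h4]]; apply/andP.
Qed.

Lemma hboxes_generate : @measurable _ 'rV[R]_d = <<s hboxes >>.
Proof.
apply/seteqP; split; last first.
  apply: smallest_sub; first exact: sigma_algebra_measurable.
  by move=> _ [a [b ->]]; exact: measurable_hbox.
apply: smallest_sub; first exact: smallest_sigma_algebra.
rewrite -bigcup_seq; apply: bigcup_sub => i _ _ [B mB <-]; rewrite setTI.
suff H : (@measurable _ (measurableTypeR R)) `<=`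
    [set B | <<s hboxes >> ((fun v : 'rV[R]_d => v ord0 i) @^-1` B)] by exact: H.
apply: smallest_sub.
  split.
  - by rewrite /= preimage_set0; exact: sigma_algebra0.
  - by move=> A /= HA; rewrite setTD preimage_setC; exact: sigma_algebraC.
  - by move=> A HA /=; rewrite preimage_bigcup; exact: sigma_algebra_bigcup.
move=> _ [[s t] _ <-] /=.
(* The slab s < y_i <= t is the increasing union of boxes that are cut at -m and m in the other
   coordinates. *)
pose a (m : nat) : 'rV[R]_d := \row_j if j == i then s else - m%:R.
pose b (m : nat) : 'rV[R]_d := \row_j if j == i then t else m%:R.
rewrite (_ : _ @^-1` _ = \bigcup_m hbox (a m) (b m)).
  by apply: sigma_algebra_bigcup => m; apply: sub_sigma_algebra; exists (a m), (b m).
apply/seteqP; split => y /=; last first.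
  by move=> [m _ /(_ i)]; rewrite /= !mxE eqxx.
move=> yi; have [m ym] := rV_coord_bound y; exists m => // j.
rewrite /= !mxE; case: eqP => [->//|_].
by have := ym j; rewrite ltr_norml in_itv/= => /andP[-> /ltW ->].
Qed.

(** Dynkin's theorem applied to the sets E over which z has integral 0 on E [&] K. Taking K to be a
    box keeps E [&] K inside the pi-system when E is a box. *)
Lemma Rintegral_hbox_eq0 (z : 'rV[R]_d -> R) (K : set 'rV[R]_d) :
  hboxes K -> mu.-integrable K (EFin \o z) ->
  (forall a b, (forall i, a ord0 i <= b ord0 i) -> \int[mu]_(x in hbox a b) z x = 0) ->
  {ae mu, forall x, K x -> z x = 0}.
Proof.
move=> hK zi z0.
have mK : measurable K by case: hK => a [b ->]; exact: measurable_hbox.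
(* The hypothesis covers ordered corners only; a box with disordered corners is empty. *)
have z0' E : hboxes E -> \int[mu]_(x in E) z x = 0.
  move=> [a [b ->]].
  have [ab|ab] := pselect (forall i, a ord0 i <= b ord0 i); first exact: z0.
  rewrite (_ : hbox a b = set0) ?Rintegral_set0//.
  rewrite -subset0 => y yb; apply: ab => i; have := yb i.
  by rewrite /= in_itv/= => /andP[/ltW /le_trans]; apply.
have iS E : measurable E -> mu.-integrable (E `&` K) (EFin \o z).
  by move=> mE; apply: integrableS zi => //; exact: measurableI.
have H E : measurable E -> \int[mu]_(x in E `&` K) z x = 0.
  rewrite hboxes_generate; move: E.
  apply: (dynkin_induction hboxes_generate hboxes_setI).
  - by rewrite setTI z0'.
  - by move=> E hE; apply: z0'; apply: hboxes_setI.
  - move=> S mS HS.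
    have : \int[mu]_(x in (S `&` K) `|` (~` S `&` K)) z x = 0.
      by rewrite -setIUl setUCr setTI z0'.
    rewrite Rintegral_setU//; last 4 first.
    + exact: measurableI.
    + by apply: measurableI => //; exact: measurableC.
    + by rewrite -setIUl setUCr; exact: iS.
    + by apply/disj_setPS => x [[? _] [? _]].
    by rewrite HS add0r.
  - move=> F mF tF HF.
    rewrite /Rintegral setI_bigcupl integral_bigcup//.
    + rewrite eseries0// => i _ _.
      rewrite -[LHS]fineK; first by rewrite [fine _]HF.
      by apply: integrable_fin_num; [exact: measurableI|exact: iS].
    + by apply: trivIset_setIr.
    + by move=> k; exact: measurableI.
    + by rewrite -setI_bigcupl; apply: iS; exact: bigcupT_measurable.
suff : ae_eq mu K (EFin \o z) (cst 0%E).
  by apply: filterS => x /[apply] -[].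
apply: integral_ae_eq => //.
  move=> E EK mE; rewrite integral0 -(setIidl EK).
  rewrite -[LHS]fineK; first by rewrite [fine _]H.
  by apply: integrable_fin_num; [exact: measurableI|exact: iS].
Qed.

End hbox_pi_system.

(** * Periodic Sobolev functions *)

Section Rintegral_extra.
Context {disp : measure_display} {T : measurableType disp} {R : realType}.
Variable mu : {measure set T -> \bar R}.

Lemma Rdominated_cvg (D : set T) (f_ : nat -> T -> R) (f g : T -> R) :
  measurable D -> (forall n, measurable_fun D (f_ n)) -> measurable_fun D f ->
  (forall x, D x -> f_ n x @[n --> \oo] --> f x) ->
  mu.-integrable D (EFin \o g) ->
  (forall n x, D x -> `|f_ n x| <= g x) ->
  \int[mu]_(x in D) f_ n x @[n --> \oo] --> \int[mu]_(x in D) f x.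
Proof.
move=> mD mf_ mf cf ig fg.
have [fi _ H] : [/\ mu.-integrable D (EFin \o f),
    (\int[mu]_(x in D) `|(f_ n x)%:E - (f x)%:E|)%E @[n --> \oo] --> 0%E &
    (\int[mu]_(x in D) (f_ n x)%:E)%E @[n --> \oo] --> (\int[mu]_(x in D) (f x)%:E)%E].
  apply: (@dominated_convergence _ _ _ mu D mD (fun n => EFin \o f_ n)
    (EFin \o f) (EFin \o g)) => //.
  - by move=> n; exact/measurable_EFinP.
  - exact/measurable_EFinP.
  - by apply: aeW => x Dx; apply: cvg_EFin; [exact: nearW|exact: cf].
  - by apply: aeW => x n Dx; rewrite /= lee_fin; exact: fg.
apply: fine_cvg; rewrite fineK//; exact: integrable_fin_num.
Qed.

Lemma Rintegral_subset (D E : set T) (f : T -> R) : E `<=` D ->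
  (forall x, D x -> ~ E x -> f x = 0) ->
  \int[mu]_(x in D) f x = \int[mu]_(x in E) f x.
Proof.
move=> ED f0; rewrite Rintegral_mkcond [RHS]Rintegral_mkcond.
apply: eq_Rintegral => x _; rewrite !patchE.
have [xE|xE] := boolP (x \in E).
  by rewrite mem_set//; apply: ED; exact/set_mem.
case: ifPn => // /set_mem xD; apply: f0 => //.
by move=> Ex; move/negP: xE; apply; exact/mem_set.
Qed.

Lemma Rintegral_null (D E : set T) (f : T -> R) : measurable D -> measurable E ->
  E `<=` D -> mu (D `\` E) = 0%E -> mu.-integrable D (EFin \o f) ->
  \int[mu]_(x in D) f x = \int[mu]_(x in E) f x.
Proof.
move=> mD mE ED DE0 fi.
rewrite -{1}(setDKU ED) Rintegral_setU//; last 3 first.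
- exact: measurableD.
- by rewrite setDKU.
- by apply/disj_setPS => x [[]].
have mDE : measurable (D `\` E) by exact: measurableD.
rewrite {1}/Rintegral null_set_integral ?add0r//.
apply: measurable_funS (measurable_int _ fi) => //; exact: subDsetl.
Qed.

End Rintegral_extra.

Section H1loc.
Context {R : realType} {d : nat}.
Local Notation mu := (@lebesgue_rV R d).
Implicit Types (D : set 'rV[R]_d) (a b h : 'rV[R]_d).

Lemma in_L2_sqint D (f : 'rV[R]_d -> R) : measurable D -> in_L2 D f <-> sqint mu D f.
Proof.
move=> mD; split=> [[mf foo]|[mf f2]]; split => //.
  apply/integrableP; split.
    by apply/measurable_EFinP; exact: measurable_funX.
  by rewrite (eq_integral (fun x => (f x ^+ 2)%:E))// => x _; rewrite /= ger0_norm ?sqr_ge0.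
have /integrableP[_] := f2.
by rewrite (eq_integral (fun x => (f x ^+ 2)%:E))// => x _; rewrite /= ger0_norm ?sqr_ge0.
Qed.

Variables (u : 'rV[R]_d -> R) (Du : 'rV[R]_d -> 'rV[R]_d).
Hypothesis uloc : in_H1loc u Du.

Lemma cover_obox : [set: 'rV[R]_d] = \bigcup_m obox (const_mx (- m%:R)) (const_mx m%:R).
Proof.
apply/seteqP; split => // y _.
have [m ym] := rV_coord_bound y; exists m => // j.
by rewrite /= !mxE in_itv/= -ltr_norml.
Qed.

Lemma H1loc_sqint a b : sqint mu (obox a b) u /\
  forall i, sqint mu (obox a b) (fun x => Du x ord0 i).
Proof.
have [uL DuL _] := uloc (@open_obox _ _ a b) (@bounded_obox _ _ a b).
by split=> [|i]; apply/in_L2_sqint => //; exact: measurable_obox.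
Qed.

Lemma obox_fin a b : (mu (obox a b) < +oo)%E.
Proof. by apply: lebesgue_bounded; [exact: measurable_obox|exact: bounded_obox]. Qed.

Lemma H1loc_integrable a b i : mu.-integrable (obox a b) (EFin \o (fun x => Du x ord0 i)).
Proof.
apply: sqint_integrable; [exact: measurable_obox|exact: obox_fin|].
exact: (H1loc_sqint a b).2.
Qed.

Lemma H1loc_measurable : measurable_fun setT u /\
  forall i, measurable_fun setT (fun x => Du x ord0 i).
Proof.
rewrite cover_obox; split=> [|i]; apply/measurable_fun_bigcup.
- by move=> m; exact: measurable_obox.
- by move=> m; exact: (sqint_measurable (H1loc_sqint _ _).1).
- by move=> m; exact: measurable_obox.
- by move=> m; exact: (sqint_measurable ((H1loc_sqint _ _).2 i)).
Qed.

Lemma hbox_sub_obox a b : hbox a b `<=` cutoff_nbhd a b.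
Proof.
move=> y yb i; have := yb i; rewrite /= !mxE !in_itv/= => /andP[? ?].
by apply/andP; split; lra.
Qed.

(** This expresses the box integrals of [Du] through [u] alone, which is how a property of [u] is
    transferred to its weak gradient. *)
Lemma hbox_limit a b i : (forall j, a ord0 j <= b ord0 j) ->
  (- \int[mu]_(x in cutoff_nbhd a b) (u x * grad (cutoff n a b) x ord0 i))
    @[n --> \oo] --> \int[mu]_(x in hbox a b) Du x ord0 i.
Proof.
move=> ab.
have [_ _ wg] := uloc (@open_obox _ _ (a - const_mx 1) (b + const_mx 2))
  (@bounded_obox _ _ _ _).
under eq_cvg do rewrite (wg _ (cutoff_test _ ab)) opprK.
have -> : \int[mu]_(x in hbox a b) Du x ord0 i =
    \int[mu]_(x in cutoff_nbhd a b) (Du x ord0 i * \1_(hbox a b) x).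
  rewrite (Rintegral_subset mu (@hbox_sub_obox a b)).
    by apply: eq_Rintegral => x xb; rewrite indicE xb mulr1.
  by move=> x _ xb; rewrite indicE memNset// mulr0.
have mDu := measurable_funTS (H1loc_measurable.2 i).
apply: (Rdominated_cvg (g := fun x => `|Du x ord0 i|)).
- exact: measurable_obox.
- move=> n; apply: measurable_funM; first exact: mDu.
  apply: continuous_measurable_rV; apply: smoothn_continuous.
  exact: smoothn_cutoff.
- apply: measurable_funM; first exact: mDu.
  by apply: measurable_indic; exact: measurable_hbox.
- by move=> x _; apply: cvgM; [exact: cvg_cst|exact: cutoff_cvg].
- by apply: integrable_norm; exact: H1loc_integrable.
- move=> n x _; rewrite normrM -[leRHS]mulr1 ler_wpM2l//.
  exact: cutoff_norm.
Qed.

Lemma grad_translation (phi psi : 'rV[R]_d -> R) h (y : 'rV[R]_d) :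
  (forall y, psi (y + h) = phi y) -> grad psi (y + h) = grad phi y.
Proof.
move=> pp; apply/rowP => i; rewrite !mxE /derive.
rewrite (_ : (fun t : R => _) = (fun t : R =>
  t^-1 *: ((phi \o shift y) (t *: basis_vec i) - phi y)))//.
by apply/funext => t /=; rewrite addrA !pp.
Qed.

Lemma obox_translation a b h :
  (fun y => y + h) @^-1` obox (a + h) (b + h) = obox a b.
Proof.
by apply/seteqP; split => y yb i; have := yb i; rewrite /= !mxE !in_itv/= ltrD2r ltrD2r.
Qed.

Lemma hbox_translation a b h :
  (fun y => y + h) @^-1` hbox (a + h) (b + h) = hbox a b.
Proof.
by apply/seteqP; split => y yb i; have := yb i; rewrite /= !mxE !in_itv/= ltrD2r lerD2r.
Qed.

Variable h : 'rV[R]_d.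
Hypothesis uh : {ae mu, forall x, u (x + h) = u x}.

Lemma measurable_grad_cutoff n a b i :
  measurable_fun setT (fun x => grad (cutoff n a b) x ord0 i).
Proof.
have [g [sg dg]] := smoothn_derive i (smoothn_cutoff n a b).
rewrite (_ : (fun x => _) = g); last first.
  by apply/funext => x; rewrite mxE; case: (dg x).
by apply: continuous_measurable_rV; exact: smoothn_continuous.
Qed.

Lemma H1per_hbox_translation a b i : (forall j, a ord0 j <= b ord0 j) ->
  \int[mu]_(x in hbox (a + h) (b + h)) Du x ord0 i = \int[mu]_(x in hbox a b) Du x ord0 i.
Proof.
move=> ab; have abh j : (a + h) ord0 j <= (b + h) ord0 j by rewrite !mxE lerD2r.
have L1 := @hbox_limit a b i ab; have L2 := @hbox_limit (a + h) (b + h) i abh.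
suff E n : \int[mu]_(x in cutoff_nbhd (a + h) (b + h))
      (u x * grad (cutoff n (a + h) (b + h)) x ord0 i) =
    \int[mu]_(x in cutoff_nbhd a b) (u x * grad (cutoff n a b) x ord0 i).
  by move: L2; under eq_cvg do rewrite E; move=> L2; exact: (norm_cvg_unique L2 L1).
have mu_ := H1loc_measurable.1.
rewrite -(@Rintegral_translation _ _ h); last 2 first.
- exact: measurable_obox.
- apply: measurable_funTS; apply: measurable_funM => //.
  exact: measurable_grad_cutoff.
have -> : (fun y => y + h) @^-1` cutoff_nbhd (a + h) (b + h) = cutoff_nbhd a b.
  by rewrite /cutoff_nbhd !(addrAC _ h) obox_translation.
apply: ae_eq_Rintegral.
- exact: measurable_obox.
- apply: measurable_funTS; apply: measurable_funM => //.
    have := measurable_fun_translation (h := h) measurableT mu_.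
    by rewrite preimage_setT.
  have := measurable_fun_translation (h := h) measurableT
    (measurable_grad_cutoff n (a + h) (b + h) i).
  by rewrite preimage_setT.
- apply: measurable_funTS; apply: measurable_funM => //.
  exact: measurable_grad_cutoff.
apply: filterS uh => x uxh _.
rewrite uxh (@grad_translation (cutoff n a b))// => y.
exact: cutoff_translation.
Qed.

Lemma H1per_grad_periodic : {ae mu, forall x, Du (x + h) = Du x}.
Proof.
(* Countably many boxes cover the space, and there are finitely many coordinates, so the exceptional
   null sets may be united. *)
suff H (i : 'I_d) (m : nat) : {ae mu, forall x, hbox (const_mx (- m%:R)) (const_mx m%:R) x ->
    Du (x + h) ord0 i - Du x ord0 i = 0}.
  have H' : {ae mu, forall x, forall i m, hbox (const_mx (- m%:R)) (const_mx m%:R) x ->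
    Du (x + h) ord0 i - Du x ord0 i = 0}.
    by apply: filter_forall => i; apply/ae_foralln => m; exact: H.
  apply: filterS H' => x Hx; apply/rowP => i; apply/eqP; rewrite -subr_eq0; apply/eqP.
  have [m _ xm] : (\bigcup_m obox (const_mx (- m%:R)) (const_mx m%:R)) x.
    by rewrite -cover_obox.
  apply: (Hx i m) => j; have := xm j; rewrite /= !mxE !in_itv/= => /andP[-> /ltW ->].
  by [].
have mDu := H1loc_measurable.2 i.
have mDuh : measurable_fun setT (fun x : 'rV[R]_d => Du (x + h) ord0 i).
  by have := measurable_fun_translation (h := h) measurableT mDu; rewrite preimage_setT.
have i1 a b : mu.-integrable (hbox a b) (EFin \o (fun x => Du x ord0 i)).
  apply: (@integrableS _ _ _ mu (cutoff_nbhd a b)).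
  - exact: measurable_obox.
  - exact: measurable_hbox.
  - exact: hbox_sub_obox.
  - exact: H1loc_integrable.
have i2 a b : mu.-integrable (hbox a b) (EFin \o (fun x => Du (x + h) ord0 i)).
  have /integrableP[_ H] := i1 (a + h) (b + h).
  apply/integrableP; split; first exact/measurable_EFinP/measurable_funTS.
  have mm : measurable_fun (hbox (a + h) (b + h)) (fun x => `|Du x ord0 i|%:E).
    by apply/measurable_EFinP; apply: measurableT_comp => //; exact: measurable_funTS.
  have := @ge0_integral_translation _ _ h _ _ (measurable_hbox (a + h) (b + h)) mm
    (fun=> normr_ge0 _).
  by rewrite hbox_translation => ->.
apply: Rintegral_hbox_eq0.
- by exists (const_mx (- m%:R)), (const_mx m%:R).
- by apply: integrableBr => //; exact: measurable_hbox.
move=> a b ab; rewrite RintegralB//; last exact: measurable_hbox.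
rewrite -(H1per_hbox_translation i ab) 
  -(@Rintegral_translation _ _ h (hbox (a + h) (b + h)) (fun x => Du x ord0 i)).
- by rewrite hbox_translation subrr.
- exact: measurable_hbox.
- exact: measurable_funTS.
Qed.

End H1loc.

(** * Gradients of periodic functions have mean zero *)

Lemma continuous_bounded_rV {R : realType} {d : nat} (D : set 'rV[R]_d)
    (f : 'rV[R]_d -> R) : continuous f -> bounded_set D ->
  exists C : R, forall x, D x -> `|f x| <= C.
Proof.
move=> cf /bounded_oboxP[L L0 DL].
pose K : set 'rV[R]_d := [set y | forall i, `[- L, L]%classic (y ord0 i)].
have cK : compact K.
  by apply: (@rV_compact _ _ (fun i => `[- L, L]%classic)) => i; exact: segment_compact.
have : compact (f @` K) by apply: continuous_compact => //; exact: continuous_subspaceT.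
move=> /compact_bounded[C [_ HC]]; exists (C + 1) => x /DL xL.
apply: (HC (C + 1)); first by rewrite ltrDl.
exists x => // i; have := xL i; rewrite /= !mxE !in_itv/= => /andP[/ltW-> /ltW->].
by [].
Qed.

Section mean_zero.
Context {R : realType} {d : nat}.
Local Notation mu := (@lebesgue_rV R d).
Variables (u : 'rV[R]_d -> R) (Du : 'rV[R]_d -> 'rV[R]_d) (M : nat).
Hypotheses (uper : in_H1per M u Du) (M1 : (1 <= M)%N).
Variable i : 'I_d.

Let s (n : nat) (t : R) := step (n.+1%:R * (t - 0)).
Let b : 'rV[R]_d := const_mx M%:R.
Let h : 'rV[R]_d := M%:R *: basis_vec i.
Let rest (n : nat) (y : 'rV[R]_d) : R := \prod_(j < d | j != i) cut1 n 0 M%:R (y ord0 j).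
(** The intersection of [cutoff_nbhd 0 b] with its translate by -h; the function g below vanishes on
    the rest of both. *)
Let S : set 'rV[R]_d := obox (const_mx (- 1)) (\row_j if j == i then 2 else M%:R + 2).

(** The cut-off rises near y_i = 0 and falls near y_i = M by the same profile, shifted by one
    period. Against a periodic function the two contributions cancel exactly, for each n. *)
Lemma H1per_mean0_cutoff n :
  \int[mu]_(x in cutoff_nbhd 0 b) (u x * grad (cutoff n 0 b) x ord0 i) = 0.
Proof.
have [uloc per] := uper.
have uh : {ae mu, forall x, u (x + h) = u x}.
  have := per (delta_mx ord0 i).
  rewrite (_ : vec_of_int _ = basis_vec i)//.
  by apply/rowP => j; rewrite !mxE eqxx; case: (j == i).
have [sg [ssg dsg]] := smooth1_derive (smooth1_step_affine n.+1%:R 0 : smooth1 (s n)).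
have restS (t : R) (x : 'rV[R]_d) : rest n (t *: basis_vec i + x) = rest n x.
  by apply: eq_bigr => j ji; rewrite !mxE (negbTE ji) mulr0 add0r.
have smrest : smoothn (rest n).
  by apply: smoothn_prod => j; apply: smoothn_coord; exact: smooth1_cut1.
pose g (y : 'rV[R]_d) := sg (y ord0 i) * rest n y.
have smg : smoothn g by apply: smoothnM => //; exact: smoothn_coord.
(* Only the factor in y_i is differentiated; [rest] does not depend on y_i, so the falling layer is
   the shift by h of the rising one. *)
have gE y : grad (cutoff n 0 b) y ord0 i = g y - g (y - h).
  have dc (t : R) : is_derive t 1 (cut1 n 0 M%:R) (sg t - sg (t - M%:R)).
    have d1 : is_derive t 1 (fun t : R => t - M%:R) 1.
      have d0 := is_deriveB (is_derive_id t 1) (is_derive_cst (M%:R : R) t 1).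
      by apply: is_derive_eq d0 _; rewrite subr0.
    have d2 := @is_derive1_comp _ (s n) (fun t => t - M%:R) t _ _ (dsg (t - M%:R)) d1.
    have d3 := is_deriveB (dsg t) d2.
    have -> : cut1 n 0 M%:R = s n - (s n \o (fun t => t - M%:R)).
      by apply/funext => z; rewrite /cut1; congr (_ - _); rewrite /s/= subr0.
    by apply: is_derive_eq d3 _; rewrite mulr1.
  have dr : is_derive y (basis_vec i) (rest n) 0 by apply: is_derive_along0.
  have dm := is_deriveM (is_derive_coord (dc (y ord0 i))) dr.
  rewrite mxE (_ : cutoff n 0 b =
      (fun y : 'rV[R]_d => cut1 n 0 M%:R (y ord0 i)) * rest n); last first.
    apply/funext => z; rewrite /cutoff (bigD1 i)//= !mxE; congr (_ * _).
    by apply: eq_bigr => j _; rewrite !mxE.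
  case: dm => _ ->; rewrite scaler0 add0r /g.
  have -> : rest n (y - h) = rest n y.
    by rewrite -(restS (- M%:R) y) /h -scaleNr addrC.
  rewrite /GRing.scale/= !mxE !eqxx mulr1; ring.
(* The step is locally constant outside [0, 1]; the wider interval [-1, 2] matches the margins of
   [cutoff_nbhd]. *)
have sg0 t : t <= -1 \/ 2 <= t -> sg t = 0.
  move=> H; have [_ <-] := dsg t.
  have E : exists c, \near t, cst c t = s n t.
    case: H => Ht; [exists 0|exists 1].
      have : \forall z \near t, z < 0 by apply: lt_nbhsl; lra.
      by apply: filterS => z z0; rewrite /s step_scale_le0//; lra.
    have : \forall z \near t, 1 < z by apply: lt_nbhsr; lra.
    by apply: filterS => z z0; rewrite /s step_scale_ge1//; lra.
  case: E => c E; have [_ //] := near_eq_is_derive E (is_derive_cst c t 1).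
have mu_ := (H1loc_measurable uloc).1.
have mg : measurable_fun setT g.
  by apply: continuous_measurable_rV; exact: smoothn_continuous.
have mgh : measurable_fun setT (fun y : 'rV[R]_d => g (y - h)).
  by have := measurable_fun_translation (h := - h) measurableT mg; rewrite preimage_setT.
have mO : measurable (cutoff_nbhd 0 b) by exact: measurable_obox.
have ui : mu.-integrable (cutoff_nbhd 0 b) (EFin \o u).
  apply: sqint_integrable => //; first exact: obox_fin.
  exact: (H1loc_sqint uloc _ _).1.
have int_ug (k : 'rV[R]_d -> R) : continuous k ->
    mu.-integrable (cutoff_nbhd 0 b) (EFin \o (fun x => u x * k x)).
  move=> ck; have [C HC] := continuous_bounded_rV ck
    (bounded_obox (0 - const_mx 1) (b + const_mx 2)).
  have mk : measurable_fun setT k by exact: continuous_measurable_rV.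
  apply: (integrable_ae_le mO _ (integrableZr_l mO C (integrable_norm ui))).
    by apply: measurable_funTS; exact: measurable_funM.
  by apply: aeW => x xO; rewrite normrM mulrC ler_wpM2r// HC.
have cg : continuous g by exact: smoothn_continuous.
have cgh : continuous (fun y : 'rV[R]_d => g (y - h)).
  move=> y; apply: (@continuous_comp _ _ _ (fun y : 'rV[R]_d => y - h) g); last exact: cg.
  by apply: continuousB; [exact: cvg_id|exact: cst_continuous].
under eq_Rintegral do rewrite gE mulrBr.
rewrite RintegralB//; [|exact: int_ug|exact: int_ug].
apply/eqP; rewrite subr_eq0; apply/eqP.
(* Both integrals are reduced to S: the first directly, the second after the change of variables x +
   h and the periodicity of u. *)
transitivity (\int[mu]_(x in S) (u x * g x)).
  apply: Rintegral_subset => x.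
    move=> xS j; have := xS j; rewrite /= !mxE !in_itv/= => /andP[x1 x2].
    apply/andP; split; first lra.
    by move: x2; case: ifP => // _ x2; apply: lt_le_trans x2 _; rewrite lerDr ler0n.
  move=> xO xS; rewrite /g sg0 ?mul0r ?mulr0//; right.
  rewrite leNgt; apply/negP => xi; apply: xS => j.
  have := xO j; rewrite /= !mxE !in_itv/= => /andP[x1 x2]; apply/andP; split; first lra.
  by case: eqP => [->|].
rewrite -(@Rintegral_translation _ _ h (cutoff_nbhd 0 b) (fun x => u x * g (x - h)))//; last first.
  by apply: measurable_funTS; exact: measurable_funM.
have mOh : measurable ((fun y => y + h) @^-1` cutoff_nbhd 0 b).
  by rewrite -[X in measurable X]setTI; exact: measurable_translation.
transitivity (\int[mu]_(x in (fun y => y + h) @^-1` cutoff_nbhd 0 b) (u x * g x)); last first.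
  apply: ae_eq_Rintegral => //.
  - by apply: measurable_funTS; exact: measurable_funM.
  - apply: measurable_funTS; apply: measurable_funM.
      by have := measurable_fun_translation (h := h) measurableT mu_; rewrite preimage_setT.
    by under eq_fun do rewrite addrK.
  - by apply: filterS uh => x -> _; rewrite addrK.
apply/esym; apply: Rintegral_subset => x.
  move=> xS j; have := xS j; rewrite /= !mxE !in_itv/= => /andP[x1 x2].
  have M0 : (0 : R) <= M%:R by rewrite ler0n.
  by move: x2; case: ifP => _ x2; rewrite ?mulr1 ?mulr0; apply/andP; split; lra.
move=> xO xS; rewrite /g sg0 ?mul0r ?mulr0//; left.
rewrite leNgt; apply/negP => xi; apply: xS => j.
have := xO j; rewrite /= !mxE !in_itv/= => /andP[].
case: eqP => [->|_]; rewrite ?mulr1 ?mulr0 => x1 x2; apply/andP; split; lra.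
Qed.

Lemma H1per_mean0 : \int[mu]_(x in cube M 0) Du x ord0 i = 0.
Proof.
have [uloc per] := uper.
have b0 j : (0 : 'rV[R]_d) ord0 j <= b ord0 j by rewrite !mxE ler0n.
have L := @hbox_limit _ _ _ _ uloc 0 b i b0.
have H0 : \int[mu]_(x in hbox 0 b) Du x ord0 i = 0.
  move: L; under eq_cvg do rewrite H1per_mean0_cutoff oppr0.
  by move=> L; apply: (norm_cvg_unique L); exact: cvg_cst.
have cE : cube M 0 = obox 0 b.
  apply/seteqP; split => y yb j; have := yb j; rewrite /= !mxE in_itv/= mulr0 add0r.
    by move=> [-> ->].
  by move=> /andP[-> ->].
(* The cell is open and the box half-open; they have the same finite measure, so the faces that make
   the difference are null. *)
rewrite cE -H0; apply/esym; apply: Rintegral_null.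
- exact: measurable_hbox.
- exact: measurable_obox.
- by move=> y yb j; have := yb j; rewrite /= !in_itv/= => /andP[-> /ltW ->].
- have bM j : (0 : 'rV[R]_d) ord0 j < b ord0 j by rewrite !mxE ltr0n.
  have mh : mu (hbox 0 b) = mu (obox 0 b).
    rewrite lebesgue_obox// lebesgue_rect.
    + congr EFin; apply: eq_bigr => j _.
      by rewrite lebesgue_measure_itv/= lte_fin bM -EFinB.
    + by move=> j; exact: measurable_itv.
    + by move=> j; rewrite lebesgue_measure_itv/= lte_fin bM -EFinB ltry.
  rewrite measureD//; [|exact: measurable_hbox|exact: measurable_obox|].
    rewrite setIidr; last first.
      by move=> y yb j; have := yb j; rewrite /= !in_itv/= => /andP[-> /ltW ->].
    transitivity (mu (obox 0 b) - mu (obox 0 b))%E; first by congr (_ - _)%E.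
    by rewrite subee// ge0_fin_numE//; exact: obox_fin.
  by have := obox_fin 0 b; rewrite -mh.
- apply: (@integrableS _ _ _ mu (cutoff_nbhd 0 b)).
  + exact: measurable_obox.
  + exact: measurable_hbox.
  + exact: hbox_sub_obox.
  + exact: (H1loc_integrable uloc).
Qed.

End mean_zero.

(** * Quadratic forms and the cell problem *)

Section forms.
Context {R : realType} {d : nat}.
Implicit Types (B : 'M[R]_d) (u v : 'rV[R]_d).

Lemma dotvE u v : dotv u v = \sum_i u ord0 i * v ord0 i.
Proof. by rewrite /dotv mxE; apply: eq_bigr => i _; rewrite mxE. Qed.

Lemma formE B u v : form B u v = \sum_i \sum_j v ord0 i * B i j * u ord0 j.
Proof.
rewrite /form mxE exchange_big; apply: eq_bigr => j _.
by rewrite !mxE mulr_suml.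
Qed.

Lemma dotv_ge0 u : 0 <= dotv u u.
Proof. by rewrite dotvE; apply: sumr_ge0 => i _; rewrite -expr2 sqr_ge0. Qed.

Lemma dotv_eq0 u : dotv u u = 0 -> u = 0.
Proof.
rewrite dotvE => /eqP; rewrite psumr_eq0 => [|i _]; last by rewrite -expr2 sqr_ge0.
move=> /allP H; apply/rowP => i; rewrite mxE; apply/eqP.
by have := H i; rewrite mem_index_enum => /(_ isT) /=; rewrite -expr2 sqrf_eq0.
Qed.

Lemma formBl B u u' v : form B (u - u') v = form B u v - form B u' v.
Proof. by rewrite /form linearB /= mulmxBr !mxE. Qed.

Lemma formDm B B' u v : form (B + B') u v = form B u v + form B' u v.
Proof. by rewrite /form mulmxDr mulmxDl mxE. Qed.

Lemma form_sum B (xi : 'rV[R]_d) (V : 'I_d -> 'rV[R]_d) :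
  form B (\sum_j xi ord0 j *: V j) (\sum_i xi ord0 i *: V i) =
  \sum_i \sum_j xi ord0 i * form B (V j) (V i) * xi ord0 j.
Proof.
rewrite /form linear_sum /= mulmx_sumr summxE exchange_big; apply: eq_bigr => j _.
rewrite linearZ /= -scalemxAr mulmx_suml mulmx_suml mxE summxE mulr_sumr.
apply: eq_bigr => i _.
by rewrite -scalemxAl -scalemxAl mxE; ring.
Qed.

Lemma measurable_form {disp : measure_display} {T : measurableType disp}
    (F : T -> 'M[R]_d) (V W : T -> 'rV[R]_d) (D : set T) :
    (forall i j, measurable_fun setT (fun y => F y i j)) ->
    (forall i, measurable_fun setT (fun y => V y ord0 i)) ->
    (forall i, measurable_fun setT (fun y => W y ord0 i)) ->
  measurable_fun D (fun y => form (F y) (V y) (W y)).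
Proof.
move=> mF mV mW; apply: measurable_funTS; under eq_fun do rewrite formE.
apply: measurable_sum => i; apply: measurable_sum => j.
by apply: measurable_funM => //; exact: measurable_funM.
Qed.

Section integrability.
Context {disp : measure_display} {T : measurableType disp}.
Variables (mu : {measure set T -> \bar R}) (D : set T).
Hypothesis mD : measurable D.

Lemma form_integrable (C : R) (B : T -> 'M[R]_d) (V W : T -> 'rV[R]_d) :
  (forall i j, measurable_fun D (fun x => B x i j)) ->
  (forall i j, {ae mu, forall x, D x -> `|B x i j| <= C}) ->
  (forall i, sqint mu D (fun x => V x ord0 i)) ->
  (forall i, sqint mu D (fun x => W x ord0 i)) ->
  mu.-integrable D (EFin \o (fun x => form (B x) (V x) (W x))).
Proof.
move=> mB BC V2 W2.
under [X in EFin \o X]eq_fun do rewrite formE.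
apply: integrable_sumr => // i; apply: integrable_sumr => // j.
apply: sqintM_integrable => //.
have := sqint_bounded mD (mB i j) (BC i j) (W2 i).
by congr sqint; apply/funext => x; rewrite mulrC.
Qed.

Lemma dotv_integrable (V W : T -> 'rV[R]_d) :
  (forall i, sqint mu D (fun x => V x ord0 i)) ->
  (forall i, sqint mu D (fun x => W x ord0 i)) ->
  mu.-integrable D (EFin \o (fun x => dotv (V x) (W x))).
Proof.
move=> V2 W2; under [X in EFin \o X]eq_fun do rewrite dotvE.
by apply: integrable_sumr => // i; exact: sqintM_integrable.
Qed.

(* Jensen: as the [G i] have mean zero, |xi + sum xi_i G_i|^2 has mean at least |xi|^2. *)
Lemma cell_matrix_coercive (alpha C : R) (B : T -> 'M[R]_d)
    (G : 'I_d -> T -> 'rV[R]_d) (xi : 'rV[R]_d) :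
  0 <= alpha -> (0 < mu D < +oo)%E ->
  (forall i j, measurable_fun D (fun x => B x i j)) ->
  (forall i j, {ae mu, forall x, D x -> `|B x i j| <= C}) ->
  {ae mu, forall x, D x -> forall xi, alpha * dotv xi xi <= form (B x) xi xi} ->
  (forall i j, sqint mu D (fun x => G i x ord0 j)) ->
  (forall i j, \int[mu]_(x in D) G i x ord0 j = 0) ->
  alpha * dotv xi xi <= form (\matrix_(i, j) ((fine (mu D))^-1 *
    \int[mu]_(x in D) form (B x) (basis_vec j + G j x) (basis_vec i + G i x))) xi xi.
Proof.
move=> a0 /andP[D0 Doo] mB BC ell G2 G0.
have m0 : 0 < fine (mu D) by rewrite fine_gt0// D0.
have V2 i j : sqint mu D (fun x => (basis_vec i + G i x) ord0 j).
  under eq_fun do rewrite mxE.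
  by apply: sqintD => //; exact: sqint_cst.
pose W x := \sum_j xi ord0 j *: G j x.
have W2 j : sqint mu D (fun x => W x ord0 j).
  under eq_fun do rewrite summxE.
  by apply: sqint_sum => // i; under eq_fun do rewrite mxE; exact: sqintZ.
have xW2 j : sqint mu D (fun x => (xi + W x) ord0 j).
  by under eq_fun do rewrite mxE; apply: sqintD => //; exact: sqint_cst.
have VE x : \sum_j xi ord0 j *: (basis_vec j + G j x) = xi + W x.
  under eq_bigr do rewrite scalerDr; rewrite big_split /=; congr (_ + _).
  by rewrite {2}(row_sum_delta xi).
rewrite formE.
(* By bilinearity, the quadratic form of the cell matrix at xi is the mean of the quadratic form of
   B at xi + W. *)
have -> : \sum_i \sum_j xi ord0 i * (\matrix_(i, j) ((fine (mu D))^-1 *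
    \int[mu]_(x in D) form (B x) (basis_vec j + G j x) (basis_vec i + G i x))) i j * xi ord0 j =
  (fine (mu D))^-1 * \int[mu]_(x in D) form (B x) (xi + W x) (xi + W x).
  under [in RHS]eq_Rintegral do rewrite -VE form_sum.
  rewrite Rintegral_sum// => [|i]; last first.
    apply: integrable_sumr => // j.
    have := integrableZr_l mD (xi ord0 i * xi ord0 j) (form_integrable mB BC (V2 j) (V2 i)).
    by congr (mu.-integrable D); apply/funext => x /=; congr EFin; ring.
  rewrite mulr_sumr; apply: eq_bigr => i _.
  have ii j : mu.-integrable D (EFin \o (fun x => xi ord0 i *
      form (B x) (basis_vec j + G j x) (basis_vec i + G i x) * xi ord0 j)).
    have := integrableZr_l mD (xi ord0 i * xi ord0 j) (form_integrable mB BC (V2 j) (V2 i)).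
    by congr (mu.-integrable D); apply/funext => x /=; congr EFin; ring.
  rewrite Rintegral_sum// mulr_sumr; apply: eq_bigr => j _.
  rewrite mxE.
  under [in RHS]eq_Rintegral do rewrite mulrAC.
  rewrite RintegralZl//; last exact: (form_integrable mB BC).
  ring.
rewrite ler_pdivlMl//.
have iW j : mu.-integrable D (EFin \o (fun x => W x ord0 j)) by exact: sqint_integrable.
have i1 : mu.-integrable D (EFin \o (fun x => \sum_j 2 * xi ord0 j * W x ord0 j)).
  by apply: integrable_sumr => // j; exact: integrableZr_l.
(* W has mean zero, so the linear term may be added for free; the integrand is then the tangent
   lower bound of |xi + W|^2, short of it by |W|^2 only. *)
have -> : fine (mu D) * (alpha * dotv xi xi) =
    \int[mu]_(x in D) (alpha * (dotv xi xi + \sum_j 2 * xi ord0 j * W x ord0 j)).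
  rewrite RintegralZl//; last by apply: integrableDr => //; exact: integrable_cstr.
  rewrite RintegralD//; last exact: integrable_cstr.
  rewrite Rintegral_cst// Rintegral_sum//; last by move=> j; exact: integrableZr_l.
  rewrite big1 ?addr0; first ring.
  move=> j _; rewrite RintegralZl// (_ : \int[mu]_(x in D) W x ord0 j = 0) ?mulr0//.
  under eq_Rintegral do rewrite summxE.
  have iG k : mu.-integrable D (EFin \o (fun x => G k x ord0 j)) by exact: sqint_integrable.
  rewrite Rintegral_sum// => [|k]; last first.
    under [X in EFin \o X]eq_fun do rewrite mxE.
    exact: integrableZr_l.
  rewrite big1// => k _; under eq_Rintegral do rewrite mxE.
  by rewrite RintegralZl// G0 mulr0.
apply: ae_le_Rintegral => //.
- apply: integrableZr_l => //; apply: integrableDr => //; exact: integrable_cstr.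
- exact: (form_integrable mB BC).
apply: filterS ell => x /[apply] /(_ (xi + W x)); apply: le_trans.
rewrite ler_wpM2l// !dotvE -big_split /=; apply: ler_sum => j _.
rewrite !mxE; nra.
Qed.

End integrability.
End forms.

(** * Differences of Sobolev functions and uniqueness of correctors *)

Section H1_sub.
Context {R : realType} {d : nat}.
Local Notation mu := (@lebesgue_rV R d).
Implicit Types (D : set 'rV[R]_d) (u v : 'rV[R]_d -> R) (Du Dv : 'rV[R]_d -> 'rV[R]_d).

Lemma smooth_cont (phi : 'rV[R]_d -> R) : smooth phi -> continuous phi.
Proof. by move=> /(_ 0%N)[]. Qed.

Lemma smooth_derivable (phi : 'rV[R]_d -> R) (i : 'I_d) x :
  smooth phi -> derivable phi x (basis_vec i).
Proof. by move=> /(_ 1%N)[_ /(_ i)[]]. Qed.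

Lemma smooth_grad (phi : 'rV[R]_d -> R) (i : 'I_d) :
  smooth phi -> smooth (fun x => grad phi x ord0 i).
Proof.
move=> sphi n; have [_ /(_ i)[_]] := sphi n.+1.
by congr continuously_derivable; apply/funext => x; rewrite mxE.
Qed.

Lemma continuous_sqint D (k : 'rV[R]_d -> R) :
  measurable D -> bounded_set D -> continuous k -> sqint mu D k.
Proof.
move=> mD bD ck; have [C HC] := continuous_bounded_rV ck bD.
split; first exact: continuous_measurable_rV.
apply: (@bounded_integrable _ _ _ mu _ mD (C ^+ 2)).
- exact: lebesgue_bounded.
- by apply: measurable_funX; exact: continuous_measurable_rV.
apply: aeW => x Dx; rewrite normrX ler_sqr ?nnegrE ?HC//.
exact: le_trans (HC x Dx).
Qed.

Lemma sqintM_continuous_integrable D u (k : 'rV[R]_d -> R) :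
  measurable D -> bounded_set D -> sqint mu D u -> continuous k ->
  mu.-integrable D (EFin \o (fun x => u x * k x)).
Proof. by move=> mD bD u2 ck; apply: sqintM_integrable => //; exact: continuous_sqint. Qed.

(** [Rintegral] is additive on integrable functions only; boundedness of D makes the test functions
    and their gradients square-integrable, hence the products integrable. *)
Lemma in_H1_sub D u Du v Dv : open D -> bounded_set D ->
  in_H1 D u Du -> in_H1 D v Dv -> in_H1 D (u \- v) (Du \- Dv).
Proof.
move=> oD bD [u2 Du2 wu] [v2 Dv2 wv].
have mD := open_measurable_rV oD.
have {}u2 := (in_L2_sqint u mD).1 u2; have {}v2 := (in_L2_sqint v mD).1 v2.
have {}Du2 i := (in_L2_sqint _ mD).1 (Du2 i).
have {}Dv2 i := (in_L2_sqint _ mD).1 (Dv2 i).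
split.
- by apply/in_L2_sqint => //; exact: sqintB.
- move=> i; apply/in_L2_sqint => //.
  under eq_fun do rewrite /= !mxE.
  exact: sqintB.
- move=> phi tphi i; have [sphi _ _] := tphi.
  have cg := smooth_cont (smooth_grad i sphi).
  have cphi := smooth_cont sphi.
  transitivity (\int[mu]_(x in D) (u x * grad phi x ord0 i - v x * grad phi x ord0 i)).
    by apply: eq_Rintegral => x _; rewrite /= mulrBl.
  rewrite RintegralB//; [|exact: sqintM_continuous_integrable..].
  rewrite wu// wv//.
  transitivity (- (\int[mu]_(x in D) (Du x ord0 i * phi x - Dv x ord0 i * phi x))).
    rewrite RintegralB//; [by ring| |].
      exact: (sqintM_continuous_integrable mD bD (Du2 i)).
    exact: (sqintM_continuous_integrable mD bD (Dv2 i)).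
  by congr (- _); apply: eq_Rintegral => x _; rewrite /= !mxE mulrBl.
Qed.

Lemma in_H1per_sub M u Du v Dv :
  in_H1per M u Du -> in_H1per M v Dv -> in_H1per M (u \- v) (Du \- Dv).
Proof.
move=> [ul up] [vl vp]; split; first by move=> O oO bO; apply: in_H1_sub; auto.
by move=> k; apply: filterS (filterI (up k) (vp k)) => x [/= -> ->].
Qed.

Lemma cubeE M (k : 'rV[int]_d) : cube M k = obox (M%:R *: vec_of_int k)
   (M%:R *: vec_of_int k + const_mx M%:R) :> set 'rV[R]_d.
Proof.
apply/seteqP; split => y yb i; have := yb i; rewrite /= !mxE in_itv/=.
  by move=> [-> ->].
by move=> /andP[-> ->].
Qed.

Lemma cube_translation M (k : 'rV[int]_d) :
  (fun y : 'rV[R]_d => y + M%:R *: vec_of_int k) @^-1` cube M k = cube M 0.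
Proof.
apply/seteqP; split => y yb i; have := yb i;
  by rewrite /= !mxE !mulr0 add0r => -[? ?]; split; lra.
Qed.

Lemma measurable_cube M (k : 'rV[int]_d) : measurable (cube M k : set 'rV[R]_d).
Proof. by rewrite cubeE; exact: measurable_obox. Qed.

Lemma cube_fin M (k : 'rV[int]_d) : (mu (cube M k) < +oo)%E.
Proof. by rewrite cubeE; exact: obox_fin. Qed.

Lemma cube_gt0 M (k : 'rV[int]_d) : (0 < M)%N -> (0 < mu (cube M k))%E.
Proof.
move=> M0; rewrite cubeE lebesgue_obox => [|i]; last by rewrite !mxE ltrDl ltr0n.
by rewrite lte_fin; apply: prodr_gt0 => i _; rewrite !mxE addrAC subrr add0r ltr0n.
Qed.

Lemma H1loc_sqint_cube u Du M (k : 'rV[int]_d) : in_H1loc u Du ->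
  forall i, sqint mu (cube M k) (fun x => Du x ord0 i).
Proof. by move=> ul i; rewrite cubeE; exact: (H1loc_sqint ul _ _).2. Qed.

(* Two correctors of the same field on cells that differ by a translation have
   the same gradient: the difference of the gradients is periodic and may be
   used as a test function in both cell problems. *)
Lemma corrector_unique (M : nat) (k : 'rV[int]_d) (alpha C : R)
    (A B : 'rV[R]_d -> 'M[R]_d) (xi : 'rV[R]_d)
    (N N' : 'rV[R]_d -> R) (DN DN' : 'rV[R]_d -> 'rV[R]_d) :
  0 < alpha ->
  (forall i j, measurable_fun setT (fun y => A y i j)) ->
  (forall i j, measurable_fun setT (fun y => B y i j)) ->
  (forall i j, {ae mu, forall y, `|B y i j| <= C}) ->
  {ae mu, forall y, forall xi, alpha * dotv xi xi <= form (B y) xi xi} ->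
  {ae mu, forall y, A (y + M%:R *: vec_of_int k) = B y} ->
  corrector A M k xi N DN -> corrector B M 0 xi N' DN' ->
  {ae mu, forall y, cube M 0 y -> DN y = DN' y}.
Proof.
move=> a0 mA mB BC ell AB [Nper eqN] [N'per eqN'].
set h := M%:R *: _ in AB.
pose v := N \- N'; pose Dv := DN \- DN'.
have vper : in_H1per M v Dv by exact: in_H1per_sub.
have DNh := H1per_grad_periodic Nper.1 (Nper.2 k).
have Dvh := H1per_grad_periodic vper.1 (vper.2 k).
have mC : measurable (cube M 0 : set 'rV[R]_d) by exact: measurable_cube.
have mC' : measurable (cube M k : set 'rV[R]_d) by exact: measurable_cube.
have mB' i j : measurable_fun (cube M 0 : set 'rV[R]_d) (fun y => B y i j).
  exact: measurable_funTS.
have BC' i j : {ae mu, forall y, cube M 0 y -> `|B y i j| <= C}.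
  by apply: filterS (BC i j) => y ? _.
have Dv2 := H1loc_sqint_cube M 0 vper.1.
have x2 (K : 'rV[R]_d -> 'rV[R]_d) : (forall i, sqint mu (cube M 0) (fun x => K x ord0 i)) ->
    forall i, sqint mu (cube M 0) (fun x => (xi + K x) ord0 i).
  move=> K2 i; under eq_fun do rewrite mxE.
  by apply: sqintD => //; apply: sqint_cst => //; exact: cube_fin.
have xDN2 := x2 _ (H1loc_sqint_cube M 0 Nper.1).
have xDN'2 := x2 _ (H1loc_sqint_cube M 0 N'per.1).
have i1 := form_integrable mC mB' BC' xDN2 Dv2.
have i2 := form_integrable mC mB' BC' xDN'2 Dv2.
have i3 := form_integrable mC mB' BC' Dv2 Dv2.
have mDN := (H1loc_measurable Nper.1).2.
have mDv := (H1loc_measurable vper.1).2.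
have mxDN i : measurable_fun setT (fun y => (xi + DN y) ord0 i).
  by under eq_fun do rewrite mxE; exact: measurable_funD.
(* The cell problem of A on the cell k, tested with v and moved to the cell 0; periodicity of the
   gradients removes the shift from [DN] and [Dv]. *)
have e1 : \int[mu]_(y in cube M 0) form (B y) (xi + DN y) (Dv y) = 0.
  have mF : measurable_fun setT (fun y => form (A y) (xi + DN y) (Dv y)).
    exact: measurable_form.
  rewrite -[RHS](eqN v Dv vper) -[RHS](@Rintegral_translation _ _ h (cube M k)
    (fun y => form (A y) (xi + DN y) (Dv y)) mC' (measurable_funTS mF)).
  rewrite cube_translation; apply: ae_eq_Rintegral => //.
  - exact: measurable_form.
  - have := measurable_fun_translation (h := h) measurableT mF.
    by rewrite preimage_setT => H; exact: measurable_funTS.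
  - apply: filterS (filterI AB (filterI DNh Dvh)) => y [-> [-> /= H]] _.
    by congr form; rewrite -[LHS]H.
have e2 := eqN' v Dv vper.
(* The two equations now have the same coefficients, cell and test function, and xi drops out of
   their difference. *)
have : \int[mu]_(y in cube M 0) form (B y) (Dv y) (Dv y) = 0.
  transitivity (\int[mu]_(y in cube M 0) (form (B y) (xi + DN y) (Dv y) -
      form (B y) (xi + DN' y) (Dv y))).
    apply: eq_Rintegral => y _; rewrite -formBl; congr form.
    by rewrite /Dv/= opprD addrACA subrr add0r.
  by rewrite RintegralB// e1 e2 subrr.
move=> e3.
have di : mu.-integrable (cube M 0) (EFin \o (fun y => dotv (Dv y) (Dv y))).
  exact: dotv_integrable.
(* Ellipticity bounds alpha |Dv|^2 by an integrand whose integral is zero. *)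
have d0 : \int[mu]_(y in cube M 0) dotv (Dv y) (Dv y) = 0.
  apply/eqP; rewrite eq_le Rintegral_ge0 ?andbT => [|y _]; last exact: dotv_ge0.
  rewrite -(ler_pM2l a0) mulr0 -e3 -RintegralZl//.
  apply: ae_le_Rintegral => //; first exact: integrableZr_l.
  by apply: filterS ell => y ? _.
have : (\int[mu]_(y in cube M 0) `|(dotv (Dv y) (Dv y))%:E| = 0)%E.
  under eq_integral do rewrite abse_EFin ger0_norm ?dotv_ge0//.
  by rewrite ge0_Rintegral_fineK// ?d0// => y _; exact: dotv_ge0.
move/(ae_eq_integral_abs mu mC ((measurable_EFinP _ _).2 (integrable_measurable di))).1.
apply: filterS => y /[apply] -[] /dotv_eq0 /eqP.
by rewrite subr_eq0 => /eqP.
Qed.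

End H1_sub.

(** * Almost sure measurability *)

Section integral_nonmeasurable.
Context {disp : measure_display} {T : measurableType disp} {R : realType}.
Variable mu : {measure set T -> \bar R}.
Import HBNNSimple.

(* The integral of a nonnegative function, measurable or not, is the supremum
   of the integrals of the simple functions below it. *)
Lemma ge0_ae_le_integralT (f g : T -> \bar R) :
  (forall x, 0 <= f x)%E -> (forall x, 0 <= g x)%E ->
  {ae mu, forall x, (f x <= g x)%E} ->
  (\int[mu]_x f x <= \int[mu]_x g x)%E.
Proof.
move=> f0 g0 [N [mN N0 fgN]]; rewrite !ge0_integralTE//.
apply: ub_ereal_sup => _ [h hf <-].
(* A simple function below f is set to zero on N: its integral does not change, and it now lies
   below g everywhere. *)
have mNC := measurableC mN.
have -> : sintegral mu h = sintegral mu (proj_nnsfun h mNC).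
  rewrite -!integralT_nnsfun; apply: ae_eq_integral => //.
  - exact/measurable_EFinP/measurable_funP.
  - exact/measurable_EFinP/measurable_funP.
  - exists N; split => // x /= H; apply: contrapT => xN; apply: H => _.
    by rewrite mindicE mem_set// mulr1.
apply: ereal_sup_ubound; exists (proj_nnsfun h mNC) => //= x.
rewrite mindicE; have [xN|xN] := boolP (x \in ~` N); last by rewrite mulr0.
rewrite mulr1; apply: le_trans (hf x) _; apply: contrapT => H.
by move/set_mem : xN; apply; exact: fgN.
Qed.

(** Used for the mean matrix, whose entries are integrals of functions that only agree almost surely
    with measurable ones. *)
Lemma ae_eq_integralT (f g : T -> \bar R) :
  {ae mu, forall x, f x = g x} -> (\int[mu]_x f x = \int[mu]_x g x)%E.
Proof.
move=> fg; rewrite integralE [RHS]integralE; congr (_ - _)%E;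
  apply/eqP; rewrite eq_le; apply/andP; split; apply: ge0_ae_le_integralT => //;
  by apply: filterS fg => x fgx; rewrite ?funeposE ?funenegE fgx.
Qed.

End integral_nonmeasurable.

(** * Essential bounds and the cells of the equivalent field *)

Section Linfty.
Context {R : realType} {d : nat}.
Local Notation mu := (@lebesgue_rV R d).
Implicit Types (D : set 'rV[R]_d) (f : 'rV[R]_d -> R).

Lemma Linfty_ae D f (C : R) : (Linfty_norm D f <= C%:E)%E ->
  {ae mu, forall x, D x -> `|f x| <= C}.
Proof.
rewrite /Linfty_norm unlock lebesgue_setT_gt0 => /ess_supP.
apply: filterS => x /= + Dx.
by rewrite patchE mem_set.
Qed.

Lemma Linfty_bounded D f : (Linfty_norm D f < +oo)%E ->
  exists C : R, {ae mu, forall x, D x -> `|f x| <= C}.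
Proof.
move=> foo; exists (fine (Linfty_norm D f)); apply: Linfty_ae.
by rewrite fineK// ge0_fin_numE//; exact: Lnorm_ge0.
Qed.

(** Turns an almost everywhere statement on a set of positive measure into a plain one when its
    conclusion does not involve x. *)
Lemma ae_ex (U : set 'rV[R]_d) (Q : 'rV[R]_d -> Prop) : measurable U ->
  (0 < mu U)%E -> {ae mu, forall x, U x -> Q x} -> exists2 x, U x & Q x.
Proof.
move=> mU U0 [N [mN N0 QN]]; apply: contrapT => H.
suff : (mu U <= 0)%E by rewrite leNgt U0.
rewrite -N0; apply: le_measure; rewrite ?inE// => x Ux.
by apply: QN => /= K; apply: H; exists x => //; exact: K.
Qed.

Section cells.
Variables (M : nat) (eps : R).
Hypotheses (M0 : (0 < M)%N) (eps0 : 0 < eps).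

Definition cell (k : 'rV[int]_d) : set 'rV[R]_d := [set x | cell_index M eps x = k].

Lemma measurable_cell k : measurable (cell k).
Proof.
have c0 : 0 < eps * M%:R by rewrite mulr_gt0// ltr0n.
rewrite (_ : cell k = rect (fun i => `[(k ord0 i)%:~R * (eps * M%:R),
  (k ord0 i + 1)%:~R * (eps * M%:R)[%classic)).
  by apply: measurable_rect => i; exact: measurable_itv.
have H x i : (Num.floor (x / (eps * M%:R)) == k ord0 i) =
    (x \in `[(k ord0 i)%:~R * (eps * M%:R), (k ord0 i + 1)%:~R * (eps * M%:R)[).
  by rewrite floor_eq ler_pdivlMr// ltr_pdivrMr// in_itv.
apply/seteqP; split => x /=.
  by move=> xk i; rewrite /= -H -xk mxE.
by move=> xk; apply/rowP => i; rewrite mxE; apply/eqP; rewrite H; exact: xk.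
Qed.

(** There are countably many cells and they cover D; if all the intersections were null, D would be
    null. *)
Lemma cell_gt0 D : measurable D -> (0 < mu D)%E ->
  exists k, (0 < mu (D `&` cell k))%E.
Proof.
move=> mD D0; apply: contrapT => H.
have Hk k : mu.-negligible (D `&` cell k).
  apply/negligibleP; first by apply: measurableI => //; exact: measurable_cell.
  apply/eqP; rewrite eq_le measure_ge0 andbT leNgt; apply/negP => K.
  by apply: H; exists k.
suff : mu D = 0%E by move=> D0'; rewrite D0' ltxx in D0.
apply: measure_negligible => //.
pose F (n : nat) := if unpickle n is Some k then D `&` cell k else set0.
apply: (@negligibleS _ _ _ _ (\bigcup_n F n)).
  move=> x Dx; exists (pickle (cell_index M eps x)) => //.
  by rewrite /F pickleK.
apply: negligible_bigcup => n; rewrite /F; case: unpickle => // .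
exact: negligible_set0.
Qed.

End cells.
End Linfty.

Section bochner.
Context {R : realType} {d : nat} {disp : measure_display} {Omega : measurableType disp}.
Variable P : probability Omega R.
Local Notation mu := (@lebesgue_rV R d).

(** As [c w] does not depend on x, it equals e + delta times the average of [a w] over U. Averages
    of simple functions are measurable in w, and convergence in the essential supremum norm carries
    over to averages. *)
Lemma L2_Linfty_measurable (D U : set 'rV[R]_d) (a : Omega -> 'rV[R]_d -> R)
    (c : Omega -> R) (e delta : R) :
  measurable D -> measurable U -> U `<=` D -> (0 < mu U < +oo)%E ->
  in_L2_Linfty P D a ->
  {ae P, forall w, {ae mu, forall x, U x -> c w = e + delta * a w x}} ->
  exists Y : Omega -> R, measurable_fun setT Y /\ {ae P, forall w, c w = Y w}.
Proof.
move=> mD mU UD /andP[U0 Uoo] [aoo [s [ss sa]] _] ca.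
have m0 : 0 < fine (mu U) by rewrite fine_gt0// U0.
pose Y n w := e + delta * ((fine (mu U))^-1 * \int[mu]_(x in U) s n w x).
have gi (g : 'rV[R]_d -> R) : in_Linfty D g -> mu.-integrable U (EFin \o g).
  move=> [mg /Linfty_bounded[C gC]].
  apply: (@bounded_integrable _ _ _ mu _ mU C) => //.
    exact: measurable_funS mg.
  by apply: filterS gC => x H Ux; apply: H; exact: UD.
have si n w : mu.-integrable U (EFin \o (fun x => s n w x)).
  have [m [E [g [mE gD sE]]]] := ss n.
  rewrite (_ : (fun x => s n w x) = (fun x => \sum_(l < m) \1_(E l) w * g l x)).
    by apply: integrable_sumr => // l; apply: integrableZr_l => //; exact: gi.
  by apply/funext => x; rewrite sE.
have mY n : measurable_fun setT (Y n).
  have [m [E [g [mE gD sE]]]] := ss n.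
  apply: measurable_funD => //; apply: measurable_funM => //; apply: measurable_funM => //.
  rewrite (_ : (fun w => _) = (fun w => \sum_(l < m) \1_(E l) w * \int[mu]_(x in U) g l x)).
    by apply: measurable_sum => l; exact: measurable_funM.
  apply/funext => w; under eq_Rintegral do rewrite sE.
  rewrite Rintegral_sum// => [|l]; last by apply: integrableZr_l => //; exact: gi.
  by apply: eq_bigr => l _; rewrite RintegralZl//; exact: gi.
have cvgY : {ae P, forall w, Y n w @[n --> \oo] --> c w}.
  apply: filterS (filterI aoo (filterI sa ca)) => w [awoo [saw caw]].
  apply/cvgrPdist_le => /= eta eta0.
  (* The summand 1 keeps the quotient meaningful when delta = 0. *)
  have eta' : 0 < eta / (`|delta| + 1) by rewrite divr_gt0// ltr_wpDl.
  have : \forall n \near \oo, (Linfty_norm D (a w \- s n w)%R <= (eta / (`|delta| + 1))%R%:E)%E.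
    have [fin /cvgr0Pnorm_le/(_ _ eta')] := (fine_cvgP _ _).1 saw.
    apply: filterS2 fin => n fn Hn; rewrite -(fineK fn) lee_fin.
    exact: le_trans (ler_norm _) Hn.
  apply: filterS => n /Linfty_ae Hn.
  have cst_i (r : R) : mu.-integrable U (EFin \o (fun=> r)) by exact: integrable_cstr.
  have -> : c w - Y n w = (fine (mu U))^-1 *
      \int[mu]_(x in U) (c w - e - delta * s n w x).
    rewrite RintegralB//; last exact: integrableZr_l.
    rewrite Rintegral_cst// RintegralZl// /Y.
    by field; rewrite gt_eqF.
  rewrite normrM normfV (gtr0_norm m0) ler_pdivrMl//.
  have ii : mu.-integrable U (EFin \o (fun x => c w - e - delta * s n w x)).
    by apply: integrableBr => //; exact: integrableZr_l.
  apply: le_trans (le_normr_Rintegral mU ii) _.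
  rewrite mulrC -Rintegral_cst//; apply: ae_le_Rintegral => //.
    exact: integrable_norm.
  apply: filterS (filterI caw Hn) => x [cx Hx] Ux.
  rewrite (cx Ux); have := Hx (UD _ Ux); rewrite /= ler_pdivlMr ?ltr_wpDl// => H.
  rewrite (_ : _ - _ = delta * (a w x - s n w x)); last by ring.
  rewrite normrM; apply: le_trans H; rewrite mulrC ler_wpM2l// lerDl//.
have [N [mN N0 YN]] := cvgY.
(* Multiplied by the indicator of the complement of N, the almost sure convergence holds at every
   sample, so the limit is measurable. *)
exists (fun w => \1_(~` N) w * c w); split; last first.
  exists N; split => // w /= H; apply: contrapT => wN; apply: H.
  by rewrite indicE mem_set// mul1r.
apply/measurable_EFinP.
apply: (@emeasurable_fun_cvg _ _ _ _ (fun n => EFin \o (fun w => \1_(~` N) w * Y n w))).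
  move=> n; apply/measurable_EFinP; apply: measurable_funM => //.
  by apply: measurable_indic; exact: measurableC.
move=> w _; apply: cvg_EFin; first exact: nearW.
have [wN|wN] := pselect (N w).
  rewrite /= indicE memNset ?mul0r; last by move=> /(_ wN).
  by under eq_cvg do rewrite /= mul0r; exact: cvg_cst.
by apply: cvgM; [exact: cvg_cst|apply: contrapT => H; apply: wN; exact: YN].
Qed.

End bochner.

(** * Equivalent matrices *)

Section random_field.
Context {R : realType} {d : nat} {disp : measure_display} {Omega : measurableType disp}.
Variables (P : probability Omega R) (tau : 'rV[int]_d -> Omega -> Omega).
Variables (A : 'rV[R]_d -> Omega -> 'M[R]_d) (M : nat) (alpha beta : R).
Variables (N : 'rV[int]_d -> 'I_d -> Omega -> 'rV[R]_d -> R)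
    (DN : 'rV[int]_d -> 'I_d -> Omega -> 'rV[R]_d -> 'rV[R]_d).
Local Notation mu := (@lebesgue_rV R d).
Hypotheses (a0 : 0 < alpha) (M0 : (0 < M)%N).
Hypotheses (erg : ergodic_action P tau) (cf : coefficient_field P A)
  (ell : elliptic P A alpha beta) (stat : stationary P A tau).
Hypothesis cor : {ae P, forall w, forall k i,
    corrector (fun y => A y w) M k (basis_vec i) (N k i w) (DN k i w)}.

(** What a single realisation must satisfy for the deterministic cell estimates to apply, for all
    cells at once and with one bound for all entries. *)
Record regular_sample (w : Omega) : Prop := RegularSample {
  sample_bounded : exists C : R, forall i j, {ae mu, forall y, `|A y w i j| <= C} ;
  sample_elliptic : {ae mu, forall y, forall xi : 'rV[R]_d,
    alpha * dotv xi xi <= form (A y w) xi xi} ;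
  sample_corrector : forall k i,
    corrector (fun y => A y w) M k (basis_vec i) (N k i w) (DN k i w) }.

Lemma ae_regular_sample : {ae P, forall w, regular_sample w}.
Proof.
have [_ _ Aoo] := cf.
apply: filterS (filterI Aoo (filterI ell cor)) => w [woo [well wcor]]; split => //.
- have /choice[C HC] : forall ij : 'I_d * 'I_d, exists C : R,
      {ae mu, forall y, `|A y w ij.1 ij.2| <= C}.
    move=> [i j]; have [_ /Linfty_bounded[C HC]] := woo i j.
    by exists C; apply: filterS HC => y /(_ I).
  exists (\sum_ij `|C ij|) => i j; apply: filterS (HC (i, j)) => y /= H.
  apply: le_trans H _; apply: le_trans (ler_norm _) _.
  by rewrite (bigD1 (i, j))//= lerDl; exact: sumr_ge0.
- by apply: filterS well => y H xi; have /andP[] := H xi.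
Qed.

Lemma measurable_sample w i j : measurable_fun setT (fun y => A y w i j).
Proof.
have [mA _ _] := cf.
exact: (measurableT_comp (mA i j) (pair2_measurable w)).
Qed.

Lemma measurable_sample_translation w h i j :
  measurable_fun setT (fun y : 'rV[R]_d => A (y + h) w i j).
Proof.
have := measurable_fun_translation (h := h) measurableT (measurable_sample w i j).
by rewrite preimage_setT.
Qed.

Lemma equivalent_matrix_coercive w k xi : regular_sample w ->
  alpha * dotv xi xi <= form (equivalent_matrix A M DN k w) xi xi.
Proof.
move=> [[C AC] Aell Acor].
apply: (@cell_matrix_coercive _ _ _ _ mu (cube M 0) (measurable_cube M 0) alpha C
  (fun y => A (y + M%:R *: vec_of_int k) w) (fun i => DN k i w)).
- exact: ltW.
- by rewrite cube_gt0//; exact: cube_fin.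
- by move=> i j; apply: measurable_funTS; exact: measurable_sample_translation.
- by move=> i j; apply: filterS (ae_translation (M%:R *: vec_of_int k) (AC i j)) => y ? _.
- by apply: filterS (ae_translation (M%:R *: vec_of_int k) Aell) => y ? _.
- by move=> i j; have [[H _] _] := Acor k i; exact: (H1loc_sqint_cube M 0 H j).
- by move=> i j; have [H _] := Acor k i; exact: (H1per_mean0 H M0).
Qed.

Lemma ae_tau k (Q : Omega -> Prop) :
  {ae P, forall w, Q w} -> {ae P, forall w, Q (tau k w)}.
Proof.
have [_ _ mt pt _] := erg.
move=> [Z [mZ Z0 QZ]]; exists (tau k @^-1` Z); split.
- by rewrite -[X in measurable X]setTI; exact: mt.
- by rewrite pt.
- by move=> w /= H; exact: QZ.
Qed.

Lemma vec_of_int_mulrn (k : 'rV[int]_d) :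
  vec_of_int (k *+ M) = M%:R *: vec_of_int k :> 'rV[R]_d.
Proof.
by apply/rowP => i; rewrite !mxE mulmxnE mulr_natl rmorphMn.
Qed.

(** The cell k is the cell 0 translated by the lattice vector M k, hence the shift [tau (k *+ M)].
    The correctors themselves may differ by constants, but [corrector_unique] identifies their
    gradients. *)
Lemma equivalent_matrix_stationary k : {ae P, forall w,
  equivalent_matrix A M DN k w = equivalent_matrix A M DN 0 (tau (k *+ M) w)}.
Proof.
apply: filterS (filterI ae_regular_sample (filterI
  (ae_tau (k *+ M) ae_regular_sample) (stat (k *+ M)))) => w [gw [gw' st]].
set w' := tau (k *+ M) w in gw' st *.
rewrite vec_of_int_mulrn in st.
have [[C BC] Bell Bcor] := gw'; have [_ _ Acor] := gw.
have DNE i : {ae mu, forall y, cube M 0 y -> DN k i w y = DN 0 i w' y}.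
  apply: (@corrector_unique _ _ M k alpha C (fun y => A y w) (fun y => A y w')
    (basis_vec i) (N k i w) (N 0 i w')) => //.
  - exact: measurable_sample.
  - exact: measurable_sample.
have mDN l v i : regular_sample v ->
    forall j, measurable_fun setT (fun y => (basis_vec i + DN l i v y) ord0 j).
  move=> [_ _ /(_ l i)[[H _] _]] j; under eq_fun do rewrite mxE.
  by apply: measurable_funD => //; exact: (H1loc_measurable H).2.
apply/matrixP => i j; rewrite !mxE; congr (_ * _).
apply: ae_eq_Rintegral.
- exact: measurable_cube.
- apply: measurable_form; [exact: measurable_sample_translation|exact: mDN|exact: mDN].
- apply: measurable_form; [exact: measurable_sample_translation|exact: mDN|exact: mDN].
apply: filterS (filterI st (filterI (DNE i) (DNE j))) => y [-> [Di Dj]] Cy.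
rewrite (Di Cy) (Dj Cy); congr form.
by congr A; apply/rowP => l; rewrite !mxE mulr0 addr0.
Qed.

Section mean.
Variables (D : set 'rV[R]_d) (eps abar delta : R)
  (A1 : 'rV[R]_d -> Omega -> 'M[R]_d) (E0 : 'M[R]_d).
Hypotheses (mD : measurable D) (D0 : (0 < mu D < +oo)%E) (eps0 : 0 < eps).
Hypothesis A1L : forall i j, in_L2_Linfty P D (fun w x => A1 x w i j).
Hypothesis A1E : {ae P, forall w, {ae mu, forall x, D x ->
    equivalent_field A M DN eps x w = E0 + delta *: A1 x w}}.
Hypothesis A1b : forall i j,
    {ae P, forall w, (Linfty_norm D (fun x => A1 x w i j) <= abar%:E)%E}.

(* The cell [k] that meets [D] carries the measurability of [A1] over to the
   equivalent matrix of that cell; stationarity carries it on to the cell 0. *)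
Lemma equivalent_matrix_ae_measurable i j : exists (K : R) (Z : Omega -> R),
  [/\ measurable_fun setT Z, {ae P, forall w, `|Z w| <= K} &
      {ae P, forall w, equivalent_matrix A M DN 0 w i j = Z w}].
Proof.
have [D00 Doo] := andP D0.
have [k Uk] := cell_gt0 M0 eps0 mD D00.
set U := D `&` cell M eps k in Uk.
have mU : measurable U by apply: measurableI => //; exact: measurable_cell.
have Uoo : (mu U < +oo)%E.
  by apply: le_lt_trans Doo; apply: le_measure; rewrite ?inE//; exact: subIsetl.
have kE : {ae P, forall w, {ae mu, forall x, U x ->
    equivalent_matrix A M DN k w i j = E0 i j + delta * A1 x w i j}}.
  apply: filterS A1E => w; apply: filterS => x + [Dx xk].
  by move=> /(_ Dx); rewrite /equivalent_field xk => ->; rewrite !mxE.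
have [Y [mY YE]] := L2_Linfty_measurable mD mU (@subIsetl _ _ _)
  (introT andP (conj Uk Uoo)) (A1L i j) kE.
(* The triangle inequality in the perturbation identity. *)
pose K := `|E0 i j| + `|delta| * abar.
have bE : {ae P, forall w, `|equivalent_matrix A M DN k w i j| <= K}.
  apply: filterS (filterI kE (A1b i j)) => w [H1 /Linfty_ae H2].
  have : {ae mu, forall x, U x -> `|equivalent_matrix A M DN k w i j| <= K}.
    apply: filterS (filterI H1 H2) => x [H3 H4] Ux.
    rewrite (H3 Ux); apply: le_trans (ler_normD _ _) _; rewrite lerD2l normrM.
    by rewrite ler_wpM2l// H4//; case: Ux.
  by case/(ae_ex mU Uk).
have [t0 tD mt pt _] := erg.
(* Stationarity is read at the sample t' w, which the shift by k *+ M sends back to w; the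
   measurable version for the cell 0 is therefore Y composed with t'. *)
pose t' := tau (- (k *+ M)).
have tK w : tau (k *+ M) (t' w) = w by rewrite -tD subrr t0.
have all : {ae P, forall w, [/\ `|Y (t' w)| <= K & equivalent_matrix A M DN 0 w i j = Y (t' w)]}.
  apply: filterS (ae_tau (- (k *+ M))
    (filterI (equivalent_matrix_stationary k) (filterI YE bE))) => w [H1 [H2 H3]].
  rewrite -/t' tK in H1.
  by split; [move: H3; rewrite H2|rewrite -H1 -H2].
exists K, (Y \o t'); split.
- exact: (measurableT_comp mY (mt _)).
- by apply: filterS all => w [].
- by apply: filterS all => w [].
Qed.

(** Pathwise coercivity is integrated over the samples. The bounded measurable versions [Z] of the
    entries make it legitimate to exchange the mean with the double sum. *)
Lemma mean_equivalent_matrix_coercive xi :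
  alpha * dotv xi xi <= form (mean_equivalent_matrix P A M DN) xi xi.
Proof.
have /choice[K HK] : forall ij : 'I_d * 'I_d, exists (K : R), exists Z : Omega -> R,
    [/\ measurable_fun setT Z, {ae P, forall w, `|Z w| <= K} &
      {ae P, forall w, equivalent_matrix A M DN 0 w ij.1 ij.2 = Z w}].
  by move=> [i j]; exact: equivalent_matrix_ae_measurable.
have {HK}/choice[Z HZ] := HK.
have PT : (P setT < +oo)%E by rewrite probability_setT ltry.
have Zi ij : P.-integrable setT (EFin \o Z ij).
  have [mZ ZK _] := HZ ij.
  apply: (@bounded_integrable _ _ _ P _ measurableT (K ij)) => //.
  by apply: filterS ZK => w ? _.
have EZ i j : mean_equivalent_matrix P A M DN i j = \int[P]_w Z (i, j) w.
  rewrite mxE unlock; congr fine; apply: ae_eq_integralT.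
  by have [_ _ ] := HZ (i, j); apply: filterS => w /= ->.
rewrite formE; under eq_bigr do under eq_bigr do rewrite EZ.
have -> : \sum_i \sum_j xi ord0 i * \int[P]_w Z (i, j) w * xi ord0 j =
    \int[P]_w (\sum_i \sum_j (xi ord0 i * xi ord0 j) * Z (i, j) w).
  rewrite Rintegral_sum// => [|i]; last first.
    by apply: integrable_sumr => // j; exact: integrableZr_l.
  apply: eq_bigr => i _; rewrite Rintegral_sum// => [|j]; last exact: integrableZr_l.
  by apply: eq_bigr => j _; rewrite RintegralZl// mulrAC.
have -> : alpha * dotv xi xi = \int[P]_w (alpha * dotv xi xi).
  rewrite Rintegral_cst// -[LHS]mulr1; congr (_ * _).
  by apply: EFin_inj; rewrite -(@probability_setT _ _ _ P) fineK// ge0_fin_numE.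
apply: ae_le_Rintegral => //.
- exact: integrable_cstr.
- by apply: integrable_sumr => // i; apply: integrable_sumr => // j; exact: integrableZr_l.
have ZE : {ae P, forall w, forall ij : 'I_d * 'I_d,
    equivalent_matrix A M DN 0 w ij.1 ij.2 = Z ij w}.
  by apply: filter_forall => ij; have [] := HZ ij.
apply: filterS (filterI ae_regular_sample ZE) => w [gw Zw] _.
apply: le_trans (equivalent_matrix_coercive 0 xi gw) _.
rewrite formE le_eqVlt; apply/orP; left; apply/eqP.
apply: eq_bigr => i _; apply: eq_bigr => j _.
by rewrite (Zw (i, j)) mulrAC.
Qed.

End mean.
End random_field.

(** * The space H^1_0 *)

Section smooth_products.
Context {R : realType} {d : nat}.
Implicit Types (f g phi psi : 'rV[R]_d -> R) (D : set 'rV[R]_d).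

(** The product rule leaves one factor undifferentiated, whose order has to be lowered to match that
    of the differentiated one. *)
Lemma continuously_derivableW n f :
  continuously_derivable n.+1 f -> continuously_derivable n f.
Proof.
elim: n f => [|n IH] f [cf Df]; first by split.
by split=> // i; have [df /IH] := Df i.
Qed.

Lemma continuously_derivableD n f g : continuously_derivable n f ->
  continuously_derivable n g -> continuously_derivable n (fun x => f x + g x).
Proof.
elim: n f g => [|n IH] f g [cf Df] [cg Dg]; split.
- by move=> x; exact: (continuousD (cf x) (cg x)).
- by [].
- by move=> x; exact: (continuousD (cf x) (cg x)).
move=> i; have [df Df'] := Df i; have [dg Dg'] := Dg i; split.
  by move=> x; exact: (derivableD (df x) (dg x)).
have -> : (fun x => 'D_(basis_vec i) (fun x => f x + g x) x) =
    (fun x => 'D_(basis_vec i) f x + 'D_(basis_vec i) g x).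
  by apply/funext => x; exact: (deriveD (df x) (dg x)).
exact: IH.
Qed.

Lemma continuously_derivableM n f g : continuously_derivable n f ->
  continuously_derivable n g -> continuously_derivable n (fun x => f x * g x).
Proof.
elim: n f g => [|n IH] f g Hf Hg; have [cf Df] := Hf; have [cg Dg] := Hg; split.
- by move=> x; exact: (continuousM (cf x) (cg x)).
- by [].
- by move=> x; exact: (continuousM (cf x) (cg x)).
move=> i; have [df Df'] := Df i; have [dg Dg'] := Dg i; split.
  by move=> x; exact: (derivableM (df x) (dg x)).
have -> : (fun x => 'D_(basis_vec i) (fun x => f x * g x) x) =
    (fun x => f x * 'D_(basis_vec i) g x + g x * 'D_(basis_vec i) f x).
  by apply/funext => x; exact: (deriveM (df x) (dg x)).
apply: continuously_derivableD; apply: IH => //; exact: continuously_derivableW.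
Qed.

Lemma smoothM f g : smooth f -> smooth g -> smooth (fun x => f x * g x).
Proof. by move=> sf sg n; exact: continuously_derivableM. Qed.

Lemma smoothB f g : smooth f -> smooth g -> smooth (fun x => f x - g x).
Proof.
move=> sf sg n.
rewrite (_ : (fun x => _) = (fun x => f x + (-1) * g x)); last first.
  by apply/funext => x; rewrite mulN1r.
apply: continuously_derivableD => //; apply: continuously_derivableM => //.
exact: (smoothn_smooth (smoothn_cst (-1))).
Qed.

Lemma smooth_coord (i : 'I_d) : smooth (fun x : 'rV[R]_d => x ord0 i).
Proof. exact/smoothn_smooth/(smoothn_coord i smooth1_id). Qed.

Lemma test_smooth D phi : test_function D phi -> smooth phi.
Proof. by case. Qed.

Lemma test_functionM D f phi : smooth f -> test_function D phi ->
  test_function D (fun x => f x * phi x).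
Proof.
move=> sf [sphi cphi Dphi].
have S : closure [set x | f x * phi x != 0] `<=` closure [set x | phi x != 0].
  by apply: closureS => x /=; rewrite mulf_eq0 negb_or => /andP[].
split; [exact: smoothM| |exact: subset_trans Dphi].
by apply: subclosed_compact cphi S; exact: closed_closure.
Qed.

Lemma test_functionB D phi psi : test_function D phi -> test_function D psi ->
  test_function D (phi \- psi).
Proof.
move=> [sphi cphi Dphi] [spsi cpsi Dpsi].
have S : closure [set x | (phi \- psi) x != 0] `<=`
    closure [set x | phi x != 0] `|` closure [set x | psi x != 0].
  rewrite -closureU; apply: closureS => x /= H; apply/orP.
  rewrite -negb_and; apply: contra H => /andP[/eqP-> /eqP->].
  by rewrite subrr.
split; first exact: smoothB.
- by apply: subclosed_compact (compactU cphi cpsi) S; exact: closed_closure.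
- by apply: subset_trans S _; rewrite subUset.
Qed.

Lemma gradB phi psi x : smooth phi -> smooth psi ->
  grad (phi \- psi) x = grad phi x - grad psi x.
Proof.
move=> sphi spsi; apply/rowP => i; rewrite !mxE.
have d1 := @smooth_derivable _ _ _ i x sphi; have d2 := @smooth_derivable _ _ _ i x spsi.
by rewrite -(deriveB d1 d2).
Qed.

Lemma grad_coordM (i : 'I_d) phi x : smooth phi ->
  grad (fun x => x ord0 i * phi x) x ord0 i = phi x + x ord0 i * grad phi x ord0 i.
Proof.
move=> sphi; rewrite !mxE.
have d1 : is_derive x (basis_vec i) (fun x : 'rV[R]_d => x ord0 i) 1.
  exact: (is_derive_coord (is_derive_id (x ord0 i) 1)).
have d2 := derivableP (@smooth_derivable _ _ _ i x sphi).
have [_ ->] := is_deriveM d1 d2.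
by rewrite /GRing.scale/= mulr1 addrC.
Qed.

End smooth_products.

Section H10.
Context {R : realType} {d : nat}.
Local Notation mu := (@lebesgue_rV R d).
Variable D : set 'rV[R]_d.
Hypotheses (oD : open D) (bD : bounded_set D).
Let mD : measurable D := open_measurable_rV oD.
Implicit Types (u v : 'rV[R]_d -> R) (Du Dv : 'rV[R]_d -> 'rV[R]_d).

Lemma in_H1_sqint u Du : in_H1 D u Du ->
  sqint mu D u /\ forall i, sqint mu D (fun x => Du x ord0 i).
Proof.
by move=> [u2 Du2 _]; split=> [|i]; apply/in_L2_sqint => //; exact: Du2.
Qed.

Lemma test_sqint phi : smooth phi ->
  sqint mu D phi /\ forall i, sqint mu D (fun x => grad phi x ord0 i).
Proof.
move=> sphi; split=> [|i]; apply: continuous_sqint => //; first exact: smooth_cont.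
exact/smooth_cont/smooth_grad.
Qed.

Lemma sqintBv (V W : 'rV[R]_d -> 'rV[R]_d) :
  (forall i, sqint mu D (fun x => V x ord0 i)) ->
  (forall i, sqint mu D (fun x => W x ord0 i)) ->
  forall i, sqint mu D (fun x => (V \- W) x ord0 i).
Proof.
by move=> V2 W2 i; under eq_fun do rewrite /= !mxE; exact: sqintB.
Qed.

Lemma H1normsq_integrable u Du : sqint mu D u ->
  (forall i, sqint mu D (fun x => Du x ord0 i)) ->
  mu.-integrable D (EFin \o (fun x => u x ^+ 2 + dotv (Du x) (Du x))).
Proof.
move=> u2 Du2; apply: integrableDr => //; first exact: u2.2.
exact: dotv_integrable.
Qed.

Lemma H1normsqE u Du : sqint mu D u ->
  (forall i, sqint mu D (fun x => Du x ord0 i)) ->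
  H1normsq D u Du = (\int[mu]_(x in D) (u x ^+ 2 + dotv (Du x) (Du x)))%:E.
Proof.
move=> u2 Du2; apply: ge0_Rintegral_fineK => //.
- by move=> x _; rewrite addr_ge0 ?sqr_ge0 ?dotv_ge0.
- exact: H1normsq_integrable.
Qed.

Lemma in_H10_approx u Du : in_H10 D u Du ->
  exists phi : nat -> 'rV[R]_d -> R, (forall n, test_function D (phi n)) /\
  \int[mu]_(x in D) ((phi n x - u x) ^+ 2 +
    dotv (grad (phi n) x - Du x) (grad (phi n) x - Du x)) @[n --> \oo] --> 0.
Proof.
move=> [/in_H1_sqint[u2 Du2] [phi [tphi cphi]]]; exists phi; split => //.
move: cphi; under eq_cvg do
  rewrite (H1normsqE (sqintB mD (test_sqint (test_smooth (tphi _))).1 u2)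
    (sqintBv (test_sqint (test_smooth (tphi _))).2 Du2)).
by move=> /fine_cvg.
Qed.

Lemma in_H10_sub u Du v Dv : in_H10 D u Du -> in_H10 D v Dv ->
  in_H10 D (u \- v) (Du \- Dv).
Proof.
move=> Hu Hv; split; first by apply: in_H1_sub => //; [exact: Hu.1|exact: Hv.1].
have [u2 Du2] := in_H1_sqint Hu.1; have [v2 Dv2] := in_H1_sqint Hv.1.
have [phi [tphi cphi]] := in_H10_approx Hu.
have [psi [tpsi cpsi]] := in_H10_approx Hv.
have tpp n : test_function D (phi n \- psi n) by exact: test_functionB.
exists (fun n => phi n \- psi n); split => //.
have phi2 n := test_sqint (test_smooth (tphi n)); have psi2 n := test_sqint (test_smooth (tpsi n)).
have pp2 n := test_sqint (test_smooth (tpp n)).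
under eq_cvg do rewrite (H1normsqE (sqintB mD (pp2 _).1 (sqintB mD u2 v2))
    (sqintBv (pp2 _).2 (sqintBv Du2 Dv2))).
apply: cvg_EFin; first exact: nearW.
pose F n := \int[mu]_(x in D) ((phi n x - u x) ^+ 2 +
    dotv (grad (phi n) x - Du x) (grad (phi n) x - Du x)).
pose G n := \int[mu]_(x in D) ((psi n x - v x) ^+ 2 +
    dotv (grad (psi n) x - Dv x) (grad (psi n) x - Dv x)).
(* The approximation errors of the difference are controlled by those of u and v through (p - q)^2
   <= 2 p^2 + 2 q^2. *)
apply: (@squeeze_cvgr _ _ _ _ (cst 0) (fun n => 2 * F n + 2 * G n)).
- apply: nearW => n; rewrite /= Rintegral_ge0 => [|x _]; last first.
    by rewrite addr_ge0 ?sqr_ge0 ?dotv_ge0.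
  have iF := H1normsq_integrable (sqintB mD (phi2 n).1 u2) (sqintBv (phi2 n).2 Du2).
  have iG := H1normsq_integrable (sqintB mD (psi2 n).1 v2) (sqintBv (psi2 n).2 Dv2).
  rewrite -!RintegralZl// -RintegralD//; [|exact: integrableZr_l..].
  apply: le_Rintegral => //.
  + exact: (H1normsq_integrable (sqintB mD (pp2 n).1 (sqintB mD u2 v2))
      (sqintBv (pp2 n).2 (sqintBv Du2 Dv2))).
  + by apply: integrableDr => //; exact: integrableZr_l.
  move=> x _; rewrite /= gradB; [|exact: (test_smooth (tphi n))|exact: (test_smooth (tpsi n))].
  have sq (a b c e : R) : (a - b - (c - e)) ^+ 2 <= 2 * (a - c) ^+ 2 + 2 * (b - e) ^+ 2.
    rewrite -subr_ge0 (_ : _ - _ = (a - c + (b - e)) ^+ 2) ?sqr_ge0//; ring.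
  rewrite !mulrDr addrACA; apply: lerD; first exact: sq.
  rewrite !dotvE !mulr_sumr -big_split; apply: ler_sum => i _ /=.
  by rewrite !mxE -!expr2; exact: sq.
- exact: cvg_cst.
- rewrite -[X in _ --> X](_ : 2 * 0 + 2 * 0 = 0); last by rewrite !mulr0 addr0.
  by apply: cvgD; apply: cvgM => //; exact: cvg_cst.
Qed.

End H10.

(** * The Poincare inequality and the energy estimate *)

Lemma young {R : realFieldType} (eta a b : R) : 0 < eta ->
  a * b <= eta / 2 * a ^+ 2 + b ^+ 2 / (2 * eta).
Proof.
move=> e0; rewrite -subr_ge0 (_ : _ - _ = (eta * a - b) ^+ 2 / (2 * eta)).
  by rewrite divr_ge0 ?sqr_ge0//; lra.
by field; rewrite gt_eqF.
Qed.

Section estimates.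
Context {R : realType} {d : nat}.
Local Notation mu := (@lebesgue_rV R d).
Variable D : set 'rV[R]_d.
Hypotheses (oD : open D) (bD : bounded_set D).
Let mD : measurable D := open_measurable_rV oD.

(* The weak gradient of [u] is tested against [x_i phi_n], where [phi_n] tends
   to [u] in H^1; in the limit, [int u^2 = - 2 int x_i u d_i u]. *)
Lemma poincare (L : R) (i : 'I_d) u Du :
  0 < L -> D `<=` obox (const_mx (- L)) (const_mx L) -> in_H10 D u Du ->
  \int[mu]_(x in D) (u x ^+ 2) <= 4 * L ^+ 2 * \int[mu]_(x in D) dotv (Du x) (Du x).
Proof.
move=> L0 DL Hu.
have [u2 Du2] := in_H1_sqint oD Hu.1.
have [phi [tphi cphi]] := in_H10_approx oD bD Hu.
have [[_ _ wu] _] := Hu.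
pose X (x : 'rV[R]_d) := x ord0 i.
have XL x : D x -> `|X x| <= L.
  by move=> /DL /(_ i); rewrite /= !mxE in_itv/= => /andP[/ltW h1 /ltW h2]; rewrite /X ler_norml h1.
have X2 x : D x -> (X x) ^+ 2 <= L ^+ 2.
  by move=> Dx; rewrite -(real_normK (num_real (X x))) ler_sqr ?nnegrE ?(ltW L0)//; exact: XL.
have mX : measurable_fun D X by apply: measurable_funTS; exact: measurable_coord.
have aeX : {ae mu, forall x, D x -> `|X x| <= L} by exact: aeW.
have Xu2 := sqint_bounded mD mX aeX u2.
have XDu2 := sqint_bounded mD mX aeX (Du2 i).
have i0 : mu.-integrable D (EFin \o (fun x => u x ^+ 2 + 2 * (X x * u x * Du x ord0 i))).
  apply: integrableDr => //; first exact: u2.2.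
  by apply: integrableZr_l => //; exact: sqintM_integrable.
(* The integrand is formally the derivative of x_i u^2 in direction i. Only Q <= 0 is needed. *)
pose Q := \int[mu]_(x in D) (u x ^+ 2 + 2 * (X x * u x * Du x ord0 i)).
have iDu2 := Du2 i; have [_ iDDu] := iDu2; have [_ iuu] := u2.
(* K collects the factors of eta when Young's inequality is applied to the three error terms of
   [QK], with |x_i| <= L. *)
pose K := (1 + L ^+ 2) / 2 * \int[mu]_(x in D) (u x ^+ 2 + (Du x ord0 i) ^+ 2).
pose h n := \int[mu]_(x in D) ((phi n x - u x) ^+ 2 +
    dotv (grad (phi n) x - Du x) (grad (phi n) x - Du x)).
have QK (eta : R) n : 0 < eta -> Q <= eta * K + eta^-1 * h n.
  move=> e0; have [phi2 Dphi2] := test_sqint oD bD (test_smooth (tphi n)).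
  have w := wu _ (test_functionM (smooth_coord i) (tphi n)) i.
  (* The weak gradient identity tested on x_i phi_n says that Z has integral 0; with u in place of
     phi_n, Z is the integrand of Q. *)
  pose Z x := u x * phi n x + X x * u x * grad (phi n) x ord0 i + X x * Du x ord0 i * phi n x.
  have iZ : mu.-integrable D (EFin \o Z).
    apply: integrableDr => //; last exact: sqintM_integrable.
    by apply: integrableDr => //; exact: sqintM_integrable.
  have Z0 : \int[mu]_(x in D) Z x = 0.
    rewrite RintegralD//; last 2 first.
    - by apply: integrableDr => //; exact: sqintM_integrable.
    - exact: sqintM_integrable.
    apply/eqP; rewrite addr_eq0; apply/eqP.
    rewrite (_ : - _ = - \int[mu]_(x in D) (Du x ord0 i * (X x * phi n x))).
      rewrite -w; apply: eq_Rintegral => x _.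
      rewrite grad_coordM; last exact: test_smooth (tphi n).
      by rewrite /X; ring.
    by congr (- _); apply: eq_Rintegral => x _; ring.
  have ih := H1normsq_integrable oD (sqintB mD phi2 u2) (sqintBv oD Dphi2 Du2).
  have iK : mu.-integrable D (EFin \o (fun x => u x ^+ 2 + Du x ord0 i ^+ 2)).
    exact: integrableDr.
  rewrite -[Q]subr0 -{1}Z0 -RintegralB// /K /h mulrA.
  rewrite -!RintegralZl// -RintegralD//; [|exact: integrableZr_l..].
  apply: le_Rintegral => //.
  - exact: integrableBr.
  - by apply: integrableDr => //; exact: integrableZr_l.
  move=> x Dx; rewrite /Z.
  set p := phi n x; set Dp := grad (phi n) x ord0 i; set D' := Du x ord0 i.
  set a := u x; set b := X x.
  have dge : (Dp - D') ^+ 2 <= dotv (grad (phi n) x - Du x) (grad (phi n) x - Du x).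
    rewrite dotvE (bigD1 i)//= !mxE -expr2 /Dp mxE /D' lerDl.
    by apply: sumr_ge0 => j _; rewrite -expr2 sqr_ge0.
  have y1 := young (- a) (p - a) e0.
  have y2 := young (- (b * a)) (Dp - D') e0.
  have y3 := young (- (b * D')) (p - a) e0.
  have b2 : b ^+ 2 <= L ^+ 2 by exact: X2.
  have q1 : eta / 2 * (- (b * a)) ^+ 2 <= eta / 2 * (L ^+ 2 * a ^+ 2).
    apply: ler_wpM2l; first lra.
    by rewrite sqrrN exprMn ler_wpM2r ?sqr_ge0.
  have q2 : eta / 2 * (- (b * D')) ^+ 2 <= eta / 2 * (L ^+ 2 * D' ^+ 2).
    apply: ler_wpM2l; first lra.
    by rewrite sqrrN exprMn ler_wpM2r ?sqr_ge0.
  have q3 : 0 <= eta / 2 * D' ^+ 2 by apply: mulr_ge0; [lra|exact: sqr_ge0].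
  have q4 : (Dp - D') ^+ 2 / (2 * eta) <=
      eta^-1 * dotv (grad (phi n) x - Du x) (grad (phi n) x - Du x).
    rewrite (_ : _ / _ = eta^-1 * ((Dp - D') ^+ 2 / 2)); last by field; rewrite gt_eqF.
    apply: ler_wpM2l; first by rewrite invr_ge0 ltW.
    have := sqr_ge0 (Dp - D'); lra.
  rewrite sqrrN in y1.
  have E : (p - a) ^+ 2 / (2 * eta) = eta^-1 * (p - a) ^+ 2 / 2 by field; rewrite gt_eqF.
  rewrite E in y1 y3.
  rewrite mulrDr [X in _ <= X + _](_ : _ = eta / 2 * a ^+ 2 + eta / 2 * (L ^+ 2 * a ^+ 2) +
     (eta / 2 * D' ^+ 2 + eta / 2 * (L ^+ 2 * D' ^+ 2))); last by rewrite /a; field.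
  (* Each error term contains either phi_n - u or the difference of their i-th derivatives, so
     Young's inequality puts it into eta K + h_n / eta. *)
  rewrite (_ : _ - _ = - a * (p - a) + - (b * a) * (Dp - D') + - (b * D') * (p - a)); last by ring.
  lra.
have Q0 : Q <= 0.
  apply/ler_addgt0Pr => e e0; rewrite add0r.
  have K0 : 0 <= K.
    rewrite mulr_ge0 ?divr_ge0 ?addr_ge0 ?sqr_ge0// Rintegral_ge0// => x _.
    by rewrite addr_ge0 ?sqr_ge0.
  (* First eta is fixed so that eta K <= e / 2, with K + 1 because K may vanish; then n is taken so
     large that h_n / eta <= e / 2. *)
  pose eta := e / (2 * (K + 1)).
  have eta0 : 0 < eta by rewrite divr_gt0//; lra.
  have [n hn] : exists n, h n <= eta * e / 2.
    have ee0 : 0 < eta * e / 2 by apply: divr_gt0 => //; exact: mulr_gt0.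
    have ch : h n @[n --> \oo] --> 0 by exact: cphi.
    move/cvgr0Pnorm_le : ch => /(_ _ ee0)[n _ /(_ n (leqnn n)) hn].
    by exists n; exact: le_trans (ler_norm _) hn.
  apply: le_trans (QK eta n eta0) _.
  have eK : eta * K <= e / 2.
    rewrite /eta (_ : _ * _ = e / 2 * (K / (K + 1))); last by field; rewrite gt_eqF//; lra.
    rewrite -[leRHS]mulr1 ler_wpM2l ?ler_pdivrMr//; lra.
  have eh : eta^-1 * h n <= e / 2.
    by rewrite ler_pdivrMl// mulrA.
  lra.
have idd := dotv_integrable mD Du2 Du2.
(* Young's inequality with eta = 1 absorbs half of u^2 and leaves 2 L^2 |Du|^2; dividing by 1/2
   gives the constant 4 L^2. *)
have : \int[mu]_(x in D) (1 / 2 * u x ^+ 2 - 2 * L ^+ 2 * dotv (Du x) (Du x)) <= 0.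
  apply: le_trans Q0; apply: le_Rintegral => //.
    by apply: integrableBr => //; exact: integrableZr_l.
  move=> x Dx.
  have y := young (u x) (- 2 * (X x * Du x ord0 i)) ltr01.
  have dge : (Du x ord0 i) ^+ 2 <= dotv (Du x) (Du x).
    rewrite dotvE (bigD1 i)//= -expr2 lerDl.
    by apply: sumr_ge0 => j _; rewrite -expr2 sqr_ge0.
  have q : (X x * Du x ord0 i) ^+ 2 <= L ^+ 2 * dotv (Du x) (Du x).
    by rewrite exprMn ler_pM ?sqr_ge0// X2.
  have -> : X x * u x * Du x ord0 i = u x * (X x * Du x ord0 i) by ring.
  rewrite exprMn sqrrN in y; lra.
rewrite RintegralB//; [|exact: integrableZr_l..].
rewrite !RintegralZl//; lra.
Qed.

(** Testing the equation of v with v gives |Dv|^2 <= (CP / alpha^2) |f|^2 in integrated form.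
    Testing the difference of the equations with w = u - v gives |Dw|^2 <= (d c / alpha)^2 |Dv|^2,
    since a d x d matrix with entries bounded by c has norm at most d c. Passing from |Dw|^2 to the
    full H^1 norm costs CP + 1. *)
Lemma energy_estimate (alpha c CP : R) (E0 : 'M[R]_d) (B : 'rV[R]_d -> 'M[R]_d) f u Du v Dv :
  (0 < d)%N -> 0 < alpha -> 0 < CP ->
  (forall z Dz, in_H10 D z Dz ->
    \int[mu]_(x in D) (z x ^+ 2) <= CP * \int[mu]_(x in D) dotv (Dz x) (Dz x)) ->
  (forall i j, measurable_fun D (fun x => B x i j)) ->
  (forall i j, {ae mu, forall x, D x -> `|B x i j - E0 i j| <= c}) ->
  (forall x xi, alpha * dotv xi xi <= form (B x) xi xi) ->
  (forall xi, alpha * dotv xi xi <= form E0 xi xi) ->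
  in_L2 D f -> weak_solution D B f u Du -> weak_solution D (fun=> E0) f v Dv ->
  (H1normsq D (u \- v)%R (Du \- Dv)%R <=
   ((CP + 1) * CP * (d%:R * c) ^+ 2 / alpha ^+ 4)%:E * L2normsq D f)%E.
Proof.
move=> d0 a0 CP0 poin mB BE Bell Eell /(in_L2_sqint f mD).1 f2 [Hu eqU] [Hv eqV].
have [u2 Du2] := in_H1_sqint oD Hu.1; have [v2 Dv2] := in_H1_sqint oD Hv.1.
pose w := u \- v; pose Dw := Du \- Dv.
have Hw : in_H10 D w Dw by exact: in_H10_sub.
have [w2 Dw2] := in_H1_sqint oD Hw.1.
pose G x := B x - E0.
have mG i j : measurable_fun D (fun x => G x i j).
  by under eq_fun do rewrite !mxE; exact: measurable_funB.
have GC i j : {ae mu, forall x, D x -> `|G x i j| <= c}.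
  by apply: filterS (BE i j) => x; rewrite !mxE.
have EC i j : {ae mu, forall x, D x -> `|E0 i j| <= \sum_k \sum_l `|E0 k l|}.
  apply: aeW => x _; rewrite (bigD1 i)//= (bigD1 j)//= -addrA lerDl.
  by rewrite addr_ge0 ?sumr_ge0// => k _; rewrite sumr_ge0.
have mE i j : measurable_fun D (fun x : 'rV[R]_d => E0 i j) by exact: measurable_cst.
have BC i j : {ae mu, forall x, D x -> `|B x i j| <= c + \sum_k \sum_l `|E0 k l|}.
  apply: filterS (filterI (BE i j) (EC i j)) => x [H1 H2] Dx.
  rewrite -[B x i j](subrK (E0 i j)); apply: le_trans (ler_normD _ _) _.
  by rewrite lerD// ?H1// H2.
have iDw := dotv_integrable mD Dw2 Dw2.
have iDv := dotv_integrable mD Dv2 Dv2.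
have iff : mu.-integrable D (EFin \o (fun x => f x ^+ 2)) by exact: f2.2.
have iBww := form_integrable mD mB BC Dw2 Dw2.
have iBuw := form_integrable mD mB BC Du2 Dw2.
have iEvw := form_integrable mD mE EC Dv2 Dw2.
have iGvw := form_integrable mD mG GC Dv2 Dw2.
set W := \int[mu]_(x in D) dotv (Dw x) (Dw x).
set V := \int[mu]_(x in D) dotv (Dv x) (Dv x).
set F := \int[mu]_(x in D) (f x ^+ 2).
have V0 : 0 <= V by apply: Rintegral_ge0 => x _; exact: dotv_ge0.
have F0 : 0 <= F by apply: Rintegral_ge0 => x _; exact: sqr_ge0.
have VF : V <= CP / alpha ^+ 2 * F.
  have h1 : alpha * V <= \int[mu]_(x in D) (f x * v x).
    rewrite -(eqV v Dv Hv) /V -RintegralZl//; apply: le_Rintegral => //.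
    - exact: integrableZr_l.
    - exact: (form_integrable mD mE EC Dv2 Dv2).
  (* With this weight the term in v^2 is at most alpha V / 2 by the Poincare inequality, and the
     left-hand side absorbs it. *)
  pose eta := alpha / CP; have eta0 : 0 < eta by rewrite divr_gt0.
  have h2 : \int[mu]_(x in D) (f x * v x) <=
      (2 * eta)^-1 * F + eta / 2 * \int[mu]_(x in D) (v x ^+ 2).
    rewrite /F -!RintegralZl//; last exact: v2.2.
    rewrite -RintegralD//; [|exact: integrableZr_l|by apply: integrableZr_l => //; exact: v2.2].
    apply: le_Rintegral => //.
    - exact: sqintM_integrable.
    - by apply: integrableDr => //; apply: integrableZr_l => //; exact: v2.2.
    by move=> x _; have := young (v x) (f x) eta0; rewrite mulrC addrC [X in X + _]mulrC.
  have h3 : eta / 2 * \int[mu]_(x in D) (v x ^+ 2) <= alpha / 2 * V.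
    apply: (@le_trans _ _ (eta / 2 * (CP * V))).
      by rewrite ler_wpM2l ?poin//; lra.
    by rewrite /eta le_eqVlt; apply/orP; left; apply/eqP; field; rewrite gt_eqF.
  have h4 : (2 * eta)^-1 * F = CP / (2 * alpha) * F.
    by rewrite /eta; field; rewrite !gt_eqF.
  have h5 : alpha * V <= CP / alpha * F.
    have -> : CP / alpha * F = 2 * (CP / (2 * alpha) * F) by field; rewrite gt_eqF.
    lra.
  rewrite -(ler_pM2l a0); apply: le_trans h5 _.
  by rewrite le_eqVlt; apply/orP; left; apply/eqP; field; rewrite gt_eqF.
have WV : W <= (d%:R * c) ^+ 2 / alpha ^+ 2 * V.
  (* B Dw = B Du - E0 Dv - G Dv; both solutions have the same right-hand side, so the first two
     terms cancel when tested with w. *)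
  have e1 : \int[mu]_(x in D) form (B x) (Dw x) (Dw x) =
      - \int[mu]_(x in D) form (G x) (Dv x) (Dw x).
    have -> : \int[mu]_(x in D) form (B x) (Dw x) (Dw x) =
      \int[mu]_(x in D) (form (B x) (Du x) (Dw x) -
         (form E0 (Dv x) (Dw x) + form (G x) (Dv x) (Dw x))).
      apply: eq_Rintegral => x _; rewrite -formDm (_ : E0 + G x = B x).
        by rewrite -formBl.
      by rewrite /G addrC subrK.
    rewrite RintegralB//; last exact: integrableDr.
    rewrite RintegralD// (eqU w Dw Hw) (eqV w Dw Hw); ring.
  have e2 : alpha * W <= alpha / 2 * W + (d%:R * c) ^+ 2 / (2 * alpha) * V.
    apply: (@le_trans _ _ (\int[mu]_(x in D) form (B x) (Dw x) (Dw x))).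
      rewrite /W -RintegralZl//; apply: le_Rintegral => //.
      exact: integrableZr_l.
    rewrite e1 /W /V -!RintegralZl// -RintegralD//; [|exact: integrableZr_l..].
    have -> : - (\int[mu]_(x in D) form (G x) (Dv x) (Dw x)) =
        \int[mu]_(x in D) ((-1) * form (G x) (Dv x) (Dw x)).
      by rewrite RintegralZl// mulN1r.
    apply: ae_le_Rintegral => //.
    - exact: integrableZr_l.
    - by apply: integrableDr => //; exact: integrableZr_l.
    have GC' : {ae mu, forall x, forall ij : 'I_d * 'I_d, D x -> `|G x ij.1 ij.2| <= c}.
      by apply: filter_forall => -[i j]; exact: GC.
    apply: filterS GC' => x H Dx.
    have dR : (0 : R) < d%:R by rewrite ltr0n.
    rewrite mulN1r formE -sumrN !dotvE.
    (* Both squared norms are spread evenly over the d^2 index pairs, so that it remains to compare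
       one entry of G at a time. *)
    have -> : alpha / 2 * (\sum_i Dw x ord0 i * Dw x ord0 i) +
        (d%:R * c) ^+ 2 / (2 * alpha) * (\sum_i Dv x ord0 i * Dv x ord0 i) =
      \sum_i \sum_j (alpha / (2 * d%:R) * Dw x ord0 i ^+ 2 +
        d%:R * c ^+ 2 / (2 * alpha) * Dv x ord0 j ^+ 2).
      under [in RHS]eq_bigr do rewrite big_split /= sumr_const card_ord.
      rewrite big_split /= sumr_const card_ord; congr (_ + _).
        rewrite mulr_sumr; apply: eq_bigr => i _.
        by rewrite -mulr_natl; field; rewrite gt_eqF.
      rewrite -[RHS]mulr_natl !mulr_sumr; apply: eq_bigr => i _.
      by field; rewrite gt_eqF.
    apply: ler_sum => i _; rewrite -sumrN; apply: ler_sum => j _.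
    have gc := H (i, j) Dx; rewrite /= in gc.
    (* The weight alpha / d makes the d terms of each row add up to alpha / 2 times the square of
       one component of Dw. *)
    have eta0 : 0 < alpha / d%:R by rewrite divr_gt0.
    have y := young (Dw x ord0 i) (- (G x i j * Dv x ord0 j)) eta0.
    rewrite -mulrA -mulrN; apply: le_trans y _; apply: lerD.
      by rewrite le_eqVlt; apply/orP; left; apply/eqP; field; rewrite gt_eqF.
    rewrite sqrrN exprMn.
    have g2 : G x i j ^+ 2 <= c ^+ 2.
      by rewrite -(real_normK (num_real (G x i j))) ler_sqr ?nnegrE// (le_trans _ gc).
    have -> : d%:R * c ^+ 2 / (2 * alpha) * Dv x ord0 j ^+ 2 =
       c ^+ 2 * Dv x ord0 j ^+ 2 / (2 * (alpha / d%:R)) by field; rewrite !gt_eqF.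
    rewrite ler_wpM2r ?ler_wpM2r ?sqr_ge0//.
    by rewrite invr_ge0; lra.
  have e3 : alpha * W <= (d%:R * c) ^+ 2 / alpha * V.
    have -> : (d%:R * c) ^+ 2 / alpha * V = 2 * ((d%:R * c) ^+ 2 / (2 * alpha) * V).
      by field; rewrite gt_eqF.
    lra.
  rewrite -(ler_pM2l a0); apply: le_trans e3 _.
  by rewrite le_eqVlt; apply/orP; left; apply/eqP; field; rewrite gt_eqF.
rewrite (H1normsqE oD w2 Dw2).
have -> : L2normsq D f = F%:E by apply: ge0_Rintegral_fineK => // x _; exact: sqr_ge0.
rewrite -EFinM lee_fin RintegralD//; last exact: w2.2.
have := poin w Dw Hw; rewrite -/W => pw.
apply: (@le_trans _ _ ((CP + 1) * W)); first by rewrite mulrDl mul1r lerD2r.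
have -> : (CP + 1) * CP * (d%:R * c) ^+ 2 / alpha ^+ 4 * F =
   (CP + 1) * ((d%:R * c) ^+ 2 / alpha ^+ 2 * (CP / alpha ^+ 2 * F)).
  by field; rewrite gt_eqF.
rewrite ler_wpM2l//; first lra.
apply: le_trans WV _; rewrite ler_wpM2l// divr_ge0 ?sqr_ge0//.
Qed.

End estimates.

(** * The error estimate *)

Lemma measurable_cell_function {R : realType} {d : nat} (M : nat) (eps : R)
    (F : 'rV[int]_d -> R) : (0 < M)%N -> 0 < eps ->
  measurable_fun [set: 'rV[R]_d] (fun x => F (cell_index M eps x)).
Proof.
move=> M0 eps0 _ Y mY; rewrite setTI.
rewrite (_ : _ @^-1` Y = \bigcup_k (if `[< Y (F k) >] then cell M eps k else set0)).
  apply: countable_bigcupT_measurable => // k.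
  by case: ifP => // _; exact: measurable_cell.
apply/seteqP; split => [x Yx|x [k _]]; last first.
  by case: asboolP => // Yk xk; rewrite /preimage/= xk.
by exists (cell_index M eps x) => //; case: asboolP.
Qed.

Theorem theorem4p5 (R : realType) (d : nat) (D : set 'rV[R]_d)
    (alpha beta abar : R) :
  (1 <= d <= 3)%N -> domain D -> bounded_set D ->
  0 < alpha -> alpha <= beta ->
  exists C1 : R, 0 < C1 /\
  forall (disp : measure_display) (Omega : measurableType disp)
    (P : probability Omega R) (tau : 'rV[int]_d -> Omega -> Omega)
    (A : 'rV[R]_d -> Omega -> 'M[R]_d) (M : nat) (eps : R)
    (N : 'rV[int]_d -> 'I_d -> Omega -> 'rV[R]_d -> R)
    (DN : 'rV[int]_d -> 'I_d -> Omega -> 'rV[R]_d -> 'rV[R]_d)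
    (A1 : 'rV[R]_d -> Omega -> 'M[R]_d) (f : 'rV[R]_d -> R)
    (uhat : Omega -> 'rV[R]_d -> R) (Duhat : Omega -> 'rV[R]_d -> 'rV[R]_d)
    (u00 : 'rV[R]_d -> R) (Du00 : 'rV[R]_d -> 'rV[R]_d),
  ergodic_action P tau ->
  coefficient_field P A ->
  elliptic P A alpha beta ->
  stationary P A tau ->
  (1 <= M)%N -> 0 < eps ->
  {ae P, forall w, forall k i,
    corrector (fun y => A y w) M k (basis_vec i) (N k i w) (DN k i w)} ->
  let Ahat := equivalent_field A M DN eps in
  let EA := mean_equivalent_matrix P A M DN in
  let delta := max_std_dev P A M DN in
  (forall i j, in_L2_Linfty P D (fun w x => A1 x w i j)) ->
  {ae P, forall w, {ae lebesgue_rV d, forall x, D x ->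
    Ahat x w = EA + delta *: A1 x w}} ->
  (forall i j,
    {ae P, forall w, (Linfty_norm D (fun x => A1 x w i j) <= abar%:E)%E}) ->
  delta < 1 ->
  in_L2 D f ->
  {ae P, forall w,
    weak_solution D (fun x => Ahat x w) f (uhat w) (Duhat w)} ->
  weak_solution D (fun=> EA) f u00 Du00 ->
  (\int[P]_w H1normsq D (uhat w \- u00)%R (Duhat w \- Du00)%R <=
    (C1 * delta ^+ 2)%:E * L2normsq D f)%E.
Proof.
move=> /andP[d0 _] [oD _ D0] bD a0 _.
have [L L0 DL] := bounded_oboxP bD.
have mD := open_measurable_rV oD.
have muD : (0 < lebesgue_rV d D < +oo)%E.
  by rewrite lebesgue_open_gt0//=; exact: lebesgue_bounded.
pose CP := 4 * L ^+ 2; have CP0 : 0 < CP by rewrite mulr_gt0// exprn_gt0.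
pose C := (CP + 1) * CP * (d%:R * abar) ^+ 2 / alpha ^+ 4.
have C0 : 0 <= C.
  rewrite divr_ge0 ?exprn_ge0 ?(ltW a0)// mulr_ge0 ?sqr_ge0// mulr_ge0//; lra.
(* C vanishes when abar = 0, whereas the constant has to be positive. *)
exists (C + 1); split; first lra.
move=> disp Omega P tau A M eps N DN A1 f uhat Duhat u00 Du00.
move=> erg cf ell stat M0 eps0 cor Ahat EA delta A1L A1E A1b _ fL2 solU solV.
have EAc := mean_equivalent_matrix_coercive a0 M0 erg cf ell stat cor mD muD eps0 A1L A1E A1b.
have poin z Dz : in_H10 D z Dz ->
    \int[lebesgue_rV d]_(x in D) (z x ^+ 2) <=
    CP * \int[lebesgue_rV d]_(x in D) dotv (Dz x) (Dz x).
  exact: (poincare oD bD (Ordinal d0) L0 DL).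
have A1b' : {ae P, forall w, forall ij : 'I_d * 'I_d,
    (Linfty_norm D (fun x => A1 x w ij.1 ij.2) <= abar%:E)%E}.
  by apply: filter_forall => -[i j]; exact: A1b.
have L2f0 : (0 <= L2normsq D f)%E by apply: integral_ge0 => x _; rewrite lee_fin sqr_ge0.
have est : {ae P, forall w, (H1normsq D (uhat w \- u00)%R (Duhat w \- Du00)%R <=
    ((C + 1) * delta ^+ 2)%:E * L2normsq D f)%E}.
  have := ae_regular_sample cf ell cor => reg.
  apply: filterS (filterI reg (filterI A1E (filterI A1b' solU))) => w [rw [A1w [bw solw]]].
  (* For a fixed sample the equivalent field is constant on each of countably many measurable
     cells. *)
  have mB i j : measurable_fun D (fun x => Ahat x w i j).
    apply: measurable_funTS.
    exact: (measurable_cell_function (fun k => equivalent_matrix A M DN k w i j) M0 eps0).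
  have BE i j : {ae lebesgue_rV d, forall x, D x ->
      `|Ahat x w i j - EA i j| <= `|delta| * abar}.
    apply: filterS (filterI A1w (Linfty_ae (bw (i, j)))) => x [H1 H2] Dx.
    (* The mean matrix is generalised so that [mxE] does not expand its entries. *)
    rewrite (H1 Dx); move: (EA) => E0.
    by rewrite !mxE addrAC subrr add0r normrM ler_wpM2l// H2.
  have Bell x xi : alpha * dotv xi xi <= Defs.form (Ahat x w) xi xi.
    exact: (equivalent_matrix_coercive a0 M0 cf _ _ rw).
  apply: le_trans (energy_estimate oD bD d0 a0 CP0 poin mB BE Bell EAc fL2 solw solV) _.
  apply: lee_wpmul2r => //; rewrite lee_fin.
  have -> : (CP + 1) * CP * (d%:R * (`|delta| * abar)) ^+ 2 / alpha ^+ 4 = C * delta ^+ 2.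
    by rewrite -(real_normK (num_real delta)) /C; field; rewrite gt_eqF.
  by rewrite ler_wpM2r ?sqr_ge0//; lra.
have H1ge0 v Dv : (0 <= H1normsq D v Dv)%E.
  by apply: integral_ge0 => x _; rewrite lee_fin addr_ge0 ?sqr_ge0 ?dotv_ge0.
have c0 : (0 <= ((C + 1) * delta ^+ 2)%:E * L2normsq D f)%E.
  by rewrite mule_ge0// lee_fin mulr_ge0 ?sqr_ge0//; lra.
(* The H^1 norm of the error is not known to be measurable in w, hence the monotonicity lemma for
   arbitrary nonnegative functions. *)
apply: (@le_trans _ _ (\int[P]_w (cst (((C + 1) * delta ^+ 2)%:E * L2normsq D f) w)))%E.
  exact: ge0_ae_le_integralT.
rewrite integral_cst// (_ : _ [set: Omega] = 1%E) ?mule1//.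
exact: probability_setT.
Qed.
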